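(* Let $T$ be a complete first-order theory, $\mathfrak{C}$ a monster model of $T$, and $\alpha$ a small ordinal. Suppose $Y\subseteq\mathfrak{C}^{\alpha}$ is closed under $\equiv_{L}^{\alpha}$, that for some $a\in Y$ the class $[a]_{\equiv_{L}^{\alpha}}$ is not $d$-bounded, and that $Y$ is pseudo strong Choquet. Then $|Y/\equiv_{L}^{\alpha}|\geq2^{\aleph_{0}}$.
   Context: $\mathfrak{C}$ is a $\kappa$-saturated, $\kappa$-homogeneous model of $T$ for some $\kappa\geq(2^{|T|})^{+}$; ''small'' means of cardinality $<\kappa$; models are small elementary substructures of $\mathfrak{C}$. A sequence is indiscernible if for every $n$ all increasing $n$-tuples from it have the same type over $\emptyset$. The Lascar graph on $\mathfrak{C}^{\alpha}$ joins two distinct tuples if they both lie on some infinite indiscernible sequence; $d_{\alpha}$ is its graph distance and $\equiv_{L}^{\alpha}$ is the equivalence relation whose classes are the connected components. A set $Z$ closed under $\equiv_{L}^{\alpha}$ is $d$-bounded if there is $n<\omega$ with $a\equiv_{L}^{\alpha}b\iff d_{\alpha}(a,b)\leq n$ for all $a,b\in Z$. For a model $M$, $S_{\alpha}(M)$ is the Stone space of complete $\alpha$-types over $M$ and $Y_{M}=\{\operatorname{tp}(a/M):a\in Y\}$ with the subspace topology. The strong Choquet game on a space $X$: in round $n$ player A chooses an open $U_{n}\subseteq V_{n-1}$ (with $V_{-1}=X$) and a point $x_{n}\in U_{n}$, and player B chooses an open $V_{n}$ with $x_{n}\in V_{n}\subseteq U_{n}$; B wins if $\bigcap_{n}V_{n}\neq\emptyset$.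 $X$ is strong Choquet if B has a winning strategy. $Y$ is pseudo strong Choquet if $Y_{M}$ is strong Choquet for every model $M$. *)

(* Defs.v *)
From mathcomp Require Import all_boot.
Set Implicit Arguments. Unset Strict Implicit. Unset Printing Implicit Defensive.

Record language := Language {
  Fun : Type; fun_ar : Fun -> nat;
  Rel : Type; rel_ar : Rel -> nat }.

Section FO.
Variable L : language.

Inductive term (V : Type) : Type :=
| tvar : V -> term V
| tapp : forall f : Fun L, ('I_(fun_ar f) -> term V) -> term V.

(* formulas with free variables in V; the existential binds a fresh
   variable (None) *)
Inductive formula : Type -> Type :=
| feq : forall V, term V -> term V -> formula V
| frel : forall V (r : Rel L), ('I_(rel_ar r) -> term V) -> formula V
| fneg : forall V, formula V -> formula V
| fand : forall V, formula V -> formula V -> formula V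
| fex : forall V, formula (option V) -> formula V.

Record structure := Structure {
  carrier :> Type;
  ifun : forall f : Fun L, ('I_(fun_ar f) -> carrier) -> carrier;
  irel : forall r : Rel L, ('I_(rel_ar r) -> carrier) -> Prop }.
Arguments ifun {s} f args.
Arguments irel {s} r args.

Fixpoint eval (M : structure) V (s : V -> M) (t : term V) : M :=
  match t with
  | tvar v => s v
  | tapp f args => ifun f (fun i => eval s (args i))
  end.

Definition ext (M : Type) V (s : V -> M) (m : M) : option V -> M :=
  fun o => match o with Some v => s v | None => m end.

Fixpoint sat (M : structure) V (phi : formula V) : (V -> M) -> Prop :=
  match phi in formula V0 return (V0 -> M) -> Prop with
  | feq _ t1 t2 => fun s => eval s t1 = eval s t2
  | frel _ r args => fun s => irel r (fun i => eval s (args i))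
  | fneg _ psi => fun s => ~ sat psi s
  | fand _ p1 p2 => fun s => sat p1 s /\ sat p2 s
  | fex _ psi => fun s => exists m : M, sat psi (ext s m)
  end.

Definition sentence := formula Empty_set.
Definition no_var (M : Type) : Empty_set -> M := fun v => match v with end.
Definition models (N : structure) (T : sentence -> Prop) :=
  forall phi, T phi -> sat phi (no_var N).

Definition complete_theory (T : sentence -> Prop) :=
  (exists N, models N T) /\
  forall phi : sentence,
    (forall N, models N T -> sat phi (no_var N)) \/
    (forall N, models N T -> sat (fneg phi) (no_var N)).

Definition closed_sub (M : structure) (P : M -> Prop) :=
  forall f (args : 'I_(fun_ar f) -> M), (forall i, P (args i)) -> P (ifun f args).

Definition induced (M : structure) (P : M -> Prop) (h : closed_sub P) : structure :=
  @Structure (sig P)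
    (fun f args => exist P (ifun f (fun i => proj1_sig (args i)))
                     (h f _ (fun i => proj2_sig (args i))))
    (fun r args => irel r (fun i => proj1_sig (args i))).

Definition elementary_sub (M : structure) (P : M -> Prop) :=
  exists h : closed_sub P, forall V (phi : formula V) (s : V -> sig P),
    sat (M := induced h) phi s <-> sat phi (fun v => proj1_sig (s v)).

Definition same_type (M : structure) V (g h : V -> M) :=
  forall phi : formula V, sat phi g <-> sat phi h.

End FO.

Definition le_card (X Y : Type) := exists f : X -> Y, injective f.
Definition lt_card (X Y : Type) := le_card X Y /\ ~ le_card Y X.

Fixpoint allP (X : Type) (P : X -> Prop) (l : seq X) : Prop :=
  match l with nil => True | x :: l' => P x /\ allP P l' end.

Section Monster.
Variable L : language.
Variable C : structure L.
(* the cardinal kappa is represented by the cardinality of the type K *)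
Variable K : Type.

Definition small (A : C -> Prop) := lt_card (sig A) K.

Definition saturated :=
  forall A : C -> Prop, small A ->
  forall p : formula L (option (sig A)) -> Prop,
    (forall l, allP p l -> exists c : C,
        allP (fun phi => sat phi (ext (fun x : sig A => proj1_sig x) c)) l) ->
    exists c : C, forall phi, p phi -> sat phi (ext (fun x : sig A => proj1_sig x) c).

Definition homogeneous :=
  forall A : C -> Prop, small A ->
  forall f : sig A -> C, same_type (fun x : sig A => proj1_sig x) f ->
  forall b : C, exists c : C,
    same_type (ext (fun x : sig A => proj1_sig x) b) (ext f c).

(* kappa >= (2^|T|)^+  where |T| = |L| + aleph_0 = |formulas over nat| *)
Definition monster (T : sentence L -> Prop) :=
  [/\ complete_theory T, models C T, inhabited C,
      lt_card (formula L nat -> bool) K & saturated /\ homogeneous].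

Variable I : Type.

Definition strict_linear_order (J : Type) (lt : J -> J -> Prop) :=
  [/\ forall x, ~ lt x x,
      forall x y z, lt x y -> lt y z -> lt x z &
      forall x y, lt x y \/ x = y \/ lt y x].

Definition indiscernible (J : Type) (lt : J -> J -> Prop) (a : J -> I -> C) :=
  forall n (i j : 'I_n -> J),
    (forall k k' : 'I_n, (k < k')%N -> lt (i k) (i k')) ->
    (forall k k' : 'I_n, (k < k')%N -> lt (j k) (j k')) ->
    same_type (fun p : 'I_n * I => a (i p.1) p.2)
              (fun p : 'I_n * I => a (j p.1) p.2).

Definition lascar_adj (a b : I -> C) :=
  a <> b /\
  exists (J : Type) (lt : J -> J -> Prop) (s : J -> I -> C),
    [/\ strict_linear_order lt, (exists e : nat -> J, injective e),
        indiscernible lt s & exists i j, s i = a /\ s j = b].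

Fixpoint dist_le (n : nat) (a b : I -> C) : Prop :=
  match n with
  | 0 => a = b
  | n'.+1 => exists c, (c = a \/ lascar_adj a c) /\ dist_le n' c b
  end.

Definition lascar_eq (a b : I -> C) := exists n, dist_le n a b.
Definition lascar_class (a : I -> C) := fun b => lascar_eq a b.
Definition lascar_closed (Y : (I -> C) -> Prop) :=
  forall a b, Y a -> lascar_eq a b -> Y b.
Definition d_bounded (Z : (I -> C) -> Prop) :=
  exists n : nat, forall a b, Z a -> Z b -> (lascar_eq a b <-> dist_le n a b).

(* tp(a/M): the set of L(M)-formulas (free variables x_i, i in I;
   parameters from M) satisfied by a *)
Definition tp (M : C -> Prop) (a : I -> C) : formula L (I + sig M) -> Prop :=
  fun phi => sat phi (fun v => match v with inl i => a i | inr m => proj1_sig m end).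

Definition YM (Y : (I -> C) -> Prop) (M : C -> Prop) :=
  fun p : formula L (I + sig M) -> Prop => exists a, Y a /\ p = @tp M a.

End Monster.
Arguments tp {L C I} M a _.
Arguments YM {L C I} Y M _.

(* subspace topology on X inside the Stone space of types: the basic open
   sets of S(M) are [phi] = {p | phi \in p} *)
Definition type_open (F : Type) (X : (F -> Prop) -> Prop) (U : (F -> Prop) -> Prop) :=
  (forall p, U p -> X p) /\
  forall p, U p -> exists phi, p phi /\ forall q, X q -> q phi -> U q.

(* strong Choquet game on the space (X, op); A's n-th move is (U_n, x_n),
   B's strategy maps the history of A's moves to V_n *)
Section Choquet.
Variable P : Type.
Variables (X : P -> Prop) (op : (P -> Prop) -> Prop).
Definition move := ((P -> Prop) * P)%type.
Definition strategy := seq move -> (P -> Prop).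
Definition subset (U V : P -> Prop) := forall x, U x -> V x.

Definition A_legal (sigma : strategy) (u : nat -> move) (n : nat) :=
  forall k, (k <= n)%N ->
    [/\ op (u k).1, (u k).1 (u k).2 &
        subset (u k).1 (if k is k'.+1 then sigma (mkseq u k) else X)].

Definition winning (sigma : strategy) :=
  (forall u n, A_legal sigma u n ->
     [/\ op (sigma (mkseq u n.+1)), sigma (mkseq u n.+1) (u n).2 &
         subset (sigma (mkseq u n.+1)) (u n).1]) /\
  (forall u, (forall n, A_legal sigma u n) ->
     exists p, forall n, sigma (mkseq u n.+1) p).

Definition strong_choquet := exists sigma, winning sigma.
End Choquet.

Definition pseudo_strong_choquet (L : language) (C : structure L) (K I : Type)
  (Y : (I -> C) -> Prop) :=
  forall M : C -> Prop, small K M -> elementary_sub M ->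
    strong_choquet (YM Y M) (type_open (YM Y M)).

(* Main.v *)
(* Fix a model enumerated by a tuple m and call two tuples near if they have the same type over
   some tuple realizing tp(m). Adjacency in the Lascar graph implies nearness (pigeonhole and
   compactness), and near tuples are at Lascar distance at most 2 (coheirs), so the lengths of
   chains of near tuples measure Lascar distance up to a factor 2, and the relation "joined by
   a chain of length at most k" is type-definable.

   Partial elementary maps moving m within its Lascar class act as Lascar strong automorphisms,
   and by compactness countably many of them move every realization of tp(a) arbitrarily far.
   Close m off to a model n on which these maps act, and take a minimal nonempty closed
   invariant set of types over n. By minimality every open set meeting it contains points of
   the same Lascar class at arbitrarily large distance. Moving n we may assume that tp(a/n)
   lies in the minimal set. A Cantor scheme in the strong Choquet game on Y_n, in which the
   open sets of level k+1 are pairwise at distance more than k, then gives continuum many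
   Lascar classes meeting Y. *)

From mathcomp Require Import all_boot.
From mathcomp Require Import boolp classical_sets filter.
Require Import Defs.
Set Implicit Arguments. Unset Strict Implicit. Unset Printing Implicit Defensive.

(** * Cardinalities *)

(** A Cantor scheme needs, inside every open set that it meets, points of one class that are
    arbitrarily far apart. Unboundedness of the class of [a] gives far points without control over
    their types. Minimality supplies this control: finitely many words in the maps bring every point
    of the minimal set back into a given open set, at a bounded cost that is fixed before the map
    moving the point far away is chosen. For each k finitely many maps suffice, so countably many
    serve all k, which keeps the model closed under them small. All tuples are indexed by types that
    embed in a fixed [S] below [K] with [S * nat] embedding in [S]. Models are built from a type [P]
    of size at most 2^|T| such that [nat -> P] embeds in [P]: a formula is handled as a definable
    set in countably many variables, and its parameters as a sequence. *)

Lemma sval_inj (X : Type) (A : X -> Prop) : injective (@sval X A).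
Proof. by move=> [x Ax] [y Ay] /= xy; exact: eq_exist. Qed.

Lemma le_card_refl X : le_card X X.
Proof. by exists id. Qed.

Lemma le_card_trans Y X Z : le_card X Y -> le_card Y Z -> le_card X Z.
Proof. by move=> [f fi] [g gi]; exists (g \o f); exact: inj_comp. Qed.

Lemma le_lt_card Y X Z : le_card X Y -> lt_card Y Z -> lt_card X Z.
Proof.
move=> XY [YZ nZY]; split; first exact: le_card_trans YZ.
by move=> ZX; apply: nZY; exact: le_card_trans ZX XY.
Qed.

Lemma le_card_total X Y : le_card X Y \/ le_card Y X.
Proof.
pose inj_graph (G : set (X * Y)) :=
  (forall x y y', G (x, y) -> G (x, y') -> y = y') /\
  (forall x x' y, G (x, y) -> G (x', y) -> x = x').
have [F FP tot|G [[Gf Gi] Gmax]] := @Zorn_bigcup (X * Y) inj_graph.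
  have join_chain p q : (\bigcup_(A in F) A)%classic p -> (\bigcup_(A in F) A)%classic q ->
      exists2 A, F A & A p /\ A q.
    move=> [A FA Ap] [B FB Bq].
    by case: (tot _ _ FA FB) => AB; [exists B|exists A] => //; split=> //; exact: AB.
  split=> [x y y'|x x' y] Gp Gq; have [A FA [Ap Aq]] := join_chain _ _ Gp Gq.
    exact: (FP _ FA).1 Ap Aq.
  exact: (FP _ FA).2 Ap Aq.
have [/choice[f fG]|/existsNP[x0 nx0]] := EM (forall x, exists y, G (x, y)).
  by left; exists f => x x' e; apply: Gi (fG x) _; rewrite e; exact: fG.
have [/choice[f fG]|/existsNP[y0 ny0]] := EM (forall y, exists x, G (x, y)).
  by right; exists f => y y' e; apply: Gf (fG y) _; rewrite e; exact: fG.
exfalso; apply: (Gmax (fun p => G p \/ p = (x0, y0))).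
  split; last by move/(_ (x0, y0) (or_intror erefl)) => G0; apply: nx0; exists y0.
  by move=> p Gp; left.
split=> [x y y'|x x' y] [G1|[-> ->]] [G2|[]].
- exact: Gf G1 G2.
- by move=> ex ey; case: nx0; exists y; rewrite -ex.
- by case: nx0; exists y'.
- by move=> ->.
- exact: Gi G1 G2.
- by move=> ex ey; case: ny0; exists x; rewrite -ey.
- by case: ny0; exists x'.
- by move=> ->.
Qed.

Lemma le_card_surj X Y (x0 : X) : le_card X Y ->
  exists g : Y -> X, forall x, exists y, g y = x.
Proof.
move=> [f fi].
have /choice[g gf] y : exists x, (exists x', f x' = y) -> f x = y.
  by have [[x <-]|ny] := EM (exists x, f x = y); [exists x|exists x0].
by exists g => x; exists (f x); apply: fi; apply: gf; exists x.
Qed.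

Lemma le_card_range X Y (g : X -> Y) : le_card (sig (fun y => exists x, g x = y)) X.
Proof.
have /choice[f fg] (y : sig (fun y => exists x, g x = y)) : exists x, g x = sval y.
  by case: y => y [x xy]; exists x.
by exists f => y y' e; apply: sval_inj; rewrite -!fg e.
Qed.

Lemma le_card_pickle (X : countType) : le_card X nat.
Proof. by exists pickle; exact: pcan_inj pickleK. Qed.

Lemma le_card_prod X X' Y Y' :
  le_card X X' -> le_card Y Y' -> le_card (X * Y) (X' * Y').
Proof.
move=> [f fi] [g gi]; exists (fun p => (f p.1, g p.2)).
by move=> [x y] [x' y'] /= [/fi -> /gi ->].
Qed.

(* A maximal family of pairwise disjoint sequences covers all of X but a
   countable remainder, which is absorbed into one of the sequences. *)
Lemma le_card_mul_nat X : le_card nat X -> le_card (X * nat) X.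
Proof.
move=> [f0 f0i].
pose disj (A : set (nat -> X)) := (forall f, A f -> injective f) /\
  (forall f g i j, A f -> A g -> f i = g j -> f = g).
have [F FP tot|A [[Ai Ad] Amax]] := @Zorn_bigcup _ disj.
  split=> [f [A FA Af]|f g i j [A FA Af] [B FB Bg]]; first exact: (FP _ FA).1.
  case: (tot _ _ FA FB) => AB; first exact: (FP _ FB).2 (AB _ Af) Bg.
  exact: (FP _ FA).2 Af (AB _ Bg).
pose R := sig (fun x => ~ exists f i, A f /\ f i = x).
have Rcount : le_card R nat.
  case: (le_card_total R nat) => // -[e ei].
  pose e' := (@sval _ _ : R -> X) \o e.
  exfalso; apply: (Amax (fun f => A f \/ f = e')).
    split=> [f Af|/(_ e' (or_intror erefl)) Ae]; first by left.
    by case: (svalP (e 0)); exists e', 0.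
  have e'i : injective e' by move=> i j /sval_inj /ei.
  split=> [f [/Ai //|-> //]|f g i j [Af|->] [Ag|->]] //.
  - exact: Ad.
  - by move=> fe; case: (svalP (e j)); exists f, i.
  - by move=> fe; case: (svalP (e i)); exists g, j.
have [[g0 Ag0]|A0] := EM (exists g, A g); last first.
  exfalso; apply: (Amax (fun f => f = f0)).
    by split=> [f Af|/(_ f0 erefl) Af]; case: A0; [exists f|exists f0].
  by split=> [f -> //|f g i j -> ->].
have [e ei] := Rcount.
have code_inj : injective (@pickle (nat * nat)%type) by exact: pcan_inj pickleK.
(* Even positions of a sequence code the pairs over its own points; the odd positions of [g0] are
   kept for the pairs over the remainder. *)
have /choice[h hP] (p : X * nat) : exists y,
    (exists f i, [/\ A f, f i = p.1 & y = f (pickle (i, p.2)).*2]) \/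
    (exists r : R, sval r = p.1 /\ y = g0 (pickle (e r, p.2)).*2.+1).
  have [[f [i [Af fi]]]|nf] := EM (exists f i, A f /\ f i = p.1).
    by exists (f (pickle (i, p.2)).*2); left; exists f, i.
  by exists (g0 (pickle (e (exist _ p.1 nf), p.2)).*2.+1); right; exists (exist _ p.1 nf).
exists h => -[x k] [x' k'].
case: (hP (x, k)) => [[f [i [Af /= fx ->]]]|[r [/= rx ->]]];
  case: (hP (x', k')) => [[f' [i' [Af' /= fx' ->]]]|[r' [/= rx' ->]]] /=.
- move=> e1; have ff' := Ad _ _ _ _ Af Af' e1; move: e1; rewrite -ff'.
  by move/(Ai _ Af)/double_inj/code_inj => [ii' ->]; rewrite -fx -fx' -ff' ii'.
- move=> e1; move: (e1); rewrite (Ad _ _ _ _ Af Ag0 e1) => /(Ai _ Ag0) /(f_equal odd).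
  by rewrite /= !odd_double.
- move=> e1; move: (e1); rewrite (Ad _ _ _ _ Ag0 Af' e1) => /(Ai _ Af') /(f_equal odd).
  by rewrite /= !odd_double.
- by move/(Ai _ Ag0) => [] /double_inj/code_inj [/ei rr' ->]; rewrite -rx -rx' rr'.
Qed.

(** A sequence of subsets of [F] is a subset of [F * nat], and [j] carries it to a subset of [F]. *)
Lemma le_card_seq_pow (F : Type) :
  le_card (F * nat) F -> le_card (nat -> F -> bool) (F -> bool).
Proof.
move=> [j ji]; exists (fun G y => `[< exists p, j p = y /\ G p.2 p.1 >]).
move=> G G' e; apply/funext => k; apply/funext => x.
have jG (H : nat -> F -> bool) : `[< exists p, j p = j (x, k) /\ H p.2 p.1 >] = H k x.
  apply/asboolP/idP => [[p [/ji -> //]]|Hkx].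
  by exists (x, k).
by rewrite -(jG G) -(jG G'); exact: (f_equal (fun f => f (j (x, k))) e).
Qed.

Section PowerSize.
Variables (P : Type) (p0 p1 : P).
Hypotheses (p01 : p0 <> p1) (powP : le_card (nat -> P) P).

Lemma le_card_nat_pow : le_card nat P.
Proof.
apply: le_card_trans powP; exists (fun k i => if i == k then p1 else p0).
move=> k k' /(f_equal (fun f => f k)); rewrite eqxx; case: eqP => // _ e.
by case: p01.
Qed.

Lemma le_card_prod_pow X Y : le_card X P -> le_card Y P -> le_card (X * Y) P.
Proof.
move=> XP YP; apply: le_card_trans (le_card_prod XP YP) _.
apply: le_card_trans powP; exists (fun p i => if i is 0 then p.1 else p.2).
by move=> [x y] [x' y'] e; congr (_, _); [exact: (f_equal (fun f => f 0) e)|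
  exact: (f_equal (fun f => f 1) e)].
Qed.

Lemma le_card_sum_pow X Y : le_card X P -> le_card Y P -> le_card (X + Y) P.
Proof.
move=> [f fi] [g gi]; apply: le_card_trans (le_card_prod_pow (le_card_refl P) (le_card_refl P)).
exists (fun u => match u with inl x => (p0, f x) | inr y => (p1, g y) end).
by move=> [x|y] [x'|y'] [] // => [/fi ->|/esym//|/gi ->].
Qed.

End PowerSize.

(** * Definable sets and saturation *)

Section ListPredicates.
Variables (X Y : Type).

Lemma allP_cat (A : X -> Prop) l1 l2 : allP A (l1 ++ l2) <-> allP A l1 /\ allP A l2.
Proof. by elim: l1 => [|x l1 IH] /=; [split=> [|[]]|rewrite IH; tauto]. Qed.

Lemma allP_imp (A B : X -> Prop) l : (forall x, A x -> B x) -> allP A l -> allP B l.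
Proof. by move=> AB; elim: l => //= x l IH [/AB ? /IH]. Qed.

Lemma allP_map (A : Y -> Prop) (f : X -> Y) l : allP A (map f l) <-> allP (fun x => A (f x)) l.
Proof. by elim: l => //= x l ->. Qed.

Lemma allP_all (A : X -> Prop) l : (forall x, A x) -> allP A l.
Proof. by move=> Aall; elim: l => //=. Qed.
End ListPredicates.

Lemma allP_flatten (X : Type) (A : X -> Prop) ls :
  allP A (flatten ls) <-> allP (allP A) ls.
Proof. by elim: ls => //= l ls IH; rewrite allP_cat IH. Qed.

Lemma allP_mem (X : eqType) (A : X -> Prop) l : allP A l <-> forall x, x \in l -> A x.
Proof.
elim: l => //= y l ->; split=> [[Ay Al] x|Al].
  by rewrite inE => /predU1P[->//|/Al].
by split=> [|x xl]; apply: Al; rewrite inE ?eqxx ?xl ?orbT.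
Qed.

Definition join X V W (g : V -> X) (w : W -> X) (u : V + W) : X :=
  match u with inl v => g v | inr x => w x end.

Section Syntax.
Variable L : language.

Fixpoint trename V W (f : V -> W) (t : term L V) : term L W :=
  match t with
  | tvar v => tvar L (f v)
  | tapp k args => tapp (fun i => trename f (args i))
  end.

Fixpoint rename V (phi : formula L V) : forall W, (V -> W) -> formula L W :=
  match phi in formula _ V0 return forall W, (V0 -> W) -> formula L W with
  | feq _ t1 t2 => fun W f => feq (trename f t1) (trename f t2)
  | frel _ r args => fun W f => frel (fun i => trename f (args i))
  | fneg _ psi => fun W f => fneg (rename psi f)
  | fand _ p1 p2 => fun W f => fand (rename p1 f) (rename p2 f)
  | fex _ psi => fun W f => fex (rename psi (omap f))
  end.

Lemma eval_trename (M : structure L) V W (f : V -> W) (t : term L V) (s : W -> M) :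
  eval s (trename f t) = eval (s \o f) t.
Proof. by elim: t => //= k args IH; congr ifun; apply/funext => i. Qed.

Lemma sat_rename (M : structure L) V (phi : formula L V) W (f : V -> W) (s : W -> M) :
  sat (rename phi f) s <-> sat phi (s \o f).
Proof.
elim: phi W f s => {V} [V t1 t2|V r args|V psi IH|V p1 IH1 p2 IH2|V psi IH] W f s /=.
- by rewrite !eval_trename.
- suff -> : (fun i => eval s (trename f (args i))) = (fun i => eval (s \o f) (args i)) by [].
  by apply/funext => i; rewrite eval_trename.
- by rewrite IH.
- by rewrite IH1 IH2.
- have E x : ext s x \o omap f = ext (s \o f) x by apply/funext => -[].
  by split=> -[x sx]; exists x; move: sx; rewrite IH E.
Qed.

Lemma term_support V (t : term L V) : exists l : seq V,
  forall (M : structure L) (s s' : V -> M), allP (fun v => s v = s' v) l -> eval s t = eval s' t.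
Proof.
elim: t => [v|k args /choice[l lP]]; first by exists [:: v] => M s s' /= [].
exists (flatten (map l (enum 'I_(fun_ar k)))) => M s s'.
rewrite allP_flatten allP_map allP_mem => ss' /=; congr ifun; apply/funext => i.
by apply: lP; apply: ss'; rewrite mem_enum.
Qed.

Lemma formula_support V (phi : formula L V) : exists l : seq V,
  forall (M : structure L) (s s' : V -> M), allP (fun v => s v = s' v) l ->
    (sat phi s <-> sat phi s').
Proof.
elim: phi => {V} [V t1 t2|V r args|V psi [l lP]|V p1 [l1 lP1] p2 [l2 lP2]|V psi [l lP]].
- have [[l1 lP1] [l2 lP2]] := (term_support t1, term_support t2).
  exists (l1 ++ l2) => M s s' /allP_cat[ss1 ss2] /=.
  by rewrite (lP1 _ _ _ ss1) (lP2 _ _ _ ss2).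
- have /choice[l lP] := fun i => term_support (args i).
  exists (flatten (map l (enum 'I_(rel_ar r)))) => M s s'.
  rewrite allP_flatten allP_map allP_mem => ss' /=.
  suff -> : (fun i => eval s (args i)) = (fun i => eval s' (args i)) by [].
  by apply/funext => i; apply: lP; apply: ss'; rewrite mem_enum.
- by exists l => M s s' /lP /= ->.
- by exists (l1 ++ l2) => M s s' /allP_cat[ss1 ss2] /=; rewrite (lP1 _ _ _ ss1) (lP2 _ _ _ ss2).
- exists (pmap id l) => M s s' ss'.
  have E x : sat psi (ext s x) <-> sat psi (ext s' x).
    by apply: lP; elim: l ss' => //= -[v|] l IH /= => [[? /IH]|/IH].
  by split=> -[x sx]; exists x; apply/E.
Qed.
End Syntax.

Section Definable.
Variables (L : language) (C : structure L).
Hypothesis C0 : inhabited C.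

(** Working with sets instead of formulas keeps syntax out of the later arguments: membership
    conditions are shown definable by closure properties. *)
Definition definable V (D : (V -> C) -> Prop) :=
  exists phi : formula L V, forall g, sat phi g <-> D g.

Lemma definable_sat V (phi : formula L V) : definable (sat phi).
Proof. by exists phi. Qed.

Lemma definable_iff V (D D' : (V -> C) -> Prop) :
  definable D -> (forall g, D g <-> D' g) -> definable D'.
Proof. by move=> [phi phiD] DD'; exists phi => g; rewrite phiD. Qed.

Lemma definable_not V (D : (V -> C) -> Prop) : definable D -> definable (fun g => ~ D g).
Proof. by move=> [phi phiD]; exists (fneg phi) => g /=; rewrite phiD. Qed.

Lemma definable_and V (D D' : (V -> C) -> Prop) :
  definable D -> definable D' -> definable (fun g => D g /\ D' g).
Proof. by move=> [phi phiD] [psi psiD]; exists (fand phi psi) => g /=; rewrite phiD psiD. Qed.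

Lemma definable_imp V (D D' : (V -> C) -> Prop) :
  definable D -> definable D' -> definable (fun g => D g -> D' g).
Proof.
move=> dD dD'; apply: definable_iff (definable_not (definable_and dD (definable_not dD'))) _.
by move=> g; split=> [n Dg|DD' [/DD']//]; apply: contrapT => n'; exact: n.
Qed.

Lemma definable_equiv V (D D' : (V -> C) -> Prop) :
  definable D -> definable D' -> definable (fun g => D g <-> D' g).
Proof. by move=> dD dD'; exact: definable_and (definable_imp dD dD') (definable_imp dD' dD). Qed.

Lemma definable_true V : definable (fun _ : V -> C => True).
Proof.
exists (fex (feq (tvar L None) (tvar L None))) => g /=; split=> // _.
by have [x] := C0; exists x.
Qed.

Lemma definable_eq V (v v' : V) : definable (fun g : V -> C => g v = g v').
Proof. by exists (feq (tvar L v) (tvar L v')). Qed.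

Lemma definable_allP V X (D : X -> (V -> C) -> Prop) (l : seq X) :
  allP (fun x => definable (D x)) l -> definable (fun g => allP (fun x => D x g) l).
Proof.
by elim: l => /= [|x l IH]; [move=> _; exact: definable_true|
  move=> [dx /IH]; exact: definable_and].
Qed.

Lemma definable_comp V W (D : (V -> C) -> Prop) (f : V -> W) :
  definable D -> definable (fun g : W -> C => D (g \o f)).
Proof. by move=> [phi phiD]; exists (rename phi f) => g; rewrite sat_rename. Qed.

Lemma definable_ex V (D : (option V -> C) -> Prop) :
  definable D -> definable (fun g => exists x, D (ext g x)).
Proof.
move=> [phi phiD]; exists (fex phi) => g /=.
by split=> -[x Dx]; exists x; apply/phiD.
Qed.

Definition supported V (D : (V -> C) -> Prop) (l : seq V) :=
  forall g g', allP (fun v => g v = g' v) l -> D g -> D g'.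

Lemma definable_supported V (D : (V -> C) -> Prop) :
  definable D -> exists l, supported D l.
Proof.
move=> [phi phiD]; have [l lP] := formula_support phi; exists l => g g' gg'.
by rewrite -!phiD (lP _ _ _ gg').
Qed.

Lemma definable_list_supported V (l : seq ((V -> C) -> Prop)) : allP (@definable V) l ->
  exists lv, supported (fun g => allP (fun D => D g) l) lv.
Proof.
move=> dl; have := @definable_allP V _ (fun D => D) l dl.
exact: definable_supported.
Qed.

(** [W] may be infinite, but [D] depends on finitely many of its coordinates. These are quantified
    one at a time, and the others may take any value. *)
Lemma definable_project V W (D : (V + W -> C) -> Prop) :
  definable D -> definable (fun g => exists w, D (join g w)).
Proof.
move=> dD.
have [l lP] : exists l : seq W, forall g w w', allP (fun x => w x = w' x) l ->
    D (join g w) -> D (join g w').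
  have [l lP] := definable_supported dD.
  exists (pmap (fun u : V + W => if u is inr x then Some x else None) l) => g w w' ww'.
  by apply: lP; elim: l ww' => //= -[v|x] l IH /= => [/IH|[? /IH]].
elim: l D dD lP => [|x0 l IH] D dD lP.
  have [c0] := C0.
  pose f (u : V + W) := if u is inl v then Some v else None.
  apply: definable_iff (definable_ex (definable_comp f dD)) _ => g.
  have E x : ext g x \o f = join g (fun=> x) by apply/funext => -[].
  by split=> [[x]|[w Dw]]; [rewrite E => Dx; exists (fun=> x)|exists c0; rewrite E; exact: lP Dw].
(* [f] makes [x0] the bound variable, so that the quantifier resets coordinate [x0] of [w]. *)
pose f (u : V + W) := match u with
  | inl v => Some (inl v)
  | inr x => if pselect (x = x0) then None else Some (inr x) end.
pose upd (w : W -> C) c x := if pselect (x = x0) then c else w x.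
have E g w c : ext (join g w) c \o f = join g (upd w c).
  by apply/funext => -[v|x] //=; rewrite /upd; case: pselect.
have := IH _ (definable_ex (definable_comp f dD)).
move=> /(_ _)/definable_iff; apply.
  move=> g w w' ww' [c]; rewrite E => Dw; exists c; rewrite E; apply: lP Dw => /=.
  split; first by rewrite /upd; case: pselect.
  by apply: allP_imp ww' => x ww'; rewrite /upd; case: pselect.
move=> g; split=> [[w [c]]|[w Dw]]; first by rewrite E; exists (upd w c).
exists w, (w x0); rewrite E; suff -> : upd w (w x0) = w by [].
by apply/funext => x; rewrite /upd; case: pselect => //= e; rewrite e.
Qed.

Section Realize.
Variables K S : Type.
Hypotheses (satC : saturated C K) (SK : lt_card S K).
Hypothesis (mulS : le_card (S * nat) S).

Lemma small_sum V W : le_card V S -> le_card W S -> le_card (V + W) S.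
Proof.
move=> [f fi] [g gi]; apply: le_card_trans mulS.
exists (fun u => match u with inl x => (f x, 0) | inr y => (g y, 1) end).
by move=> [x|y] [x'|y'] [] // => [/fi ->|/gi ->].
Qed.

Lemma small_mul V W : le_card V nat -> le_card W S -> le_card (V * W) S.
Proof.
move=> Vn WS; apply: le_card_trans mulS; apply: le_card_trans (le_card_prod WS Vn).
by exists (fun p => (p.2, p.1)) => -[x y] [x' y'] [-> ->].
Qed.

(** Saturation takes parameters from a small set of elements; renaming along [r] passes from the
    indices of [g] to its values. *)
Lemma realize_one V (g : V -> C) (p : ((option V -> C) -> Prop) -> Prop) :
  le_card V S -> (forall D, p D -> definable D) ->
  (forall l, allP p l -> exists c, allP (fun D => D (ext g c)) l) ->
  exists c, forall D, p D -> D (ext g c).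
Proof.
move=> VS pdef pfin; pose A y := exists v, g v = y.
pose r v : sig A := exist _ (g v) (ex_intro _ v erefl).
have smA : small K A by apply: le_lt_card SK; apply: le_card_trans VS; exact: le_card_range.
have extr c : ext (fun x : sig A => sval x) c \o omap r = ext g c by apply/funext => -[].
pose p' psi := exists D phi,
  [/\ p D, forall h, sat phi h <-> D h & psi = rename phi (omap r)].
have [|c cP] := satC smA (p := p').
  move=> l pl; suff [l' [pl' ll']] : exists l', allP p l' /\ forall c,
      allP (fun D => D (ext g c)) l' ->
      allP (fun phi => sat phi (ext (fun x : sig A => sval x) c)) l.
    by have [c] := pfin _ pl'; exists c; exact: ll'.
  elim: l pl => [|psi l IH] /= => [_|[[D [phi [pD phiD ->]]] /IH[l' [pl' ll']]]].
    by exists [::].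
  exists (D :: l'); split=> // c [Dc /ll' ?]; split=> //.
  by apply/sat_rename; rewrite extr; apply/phiD.
exists c => D pD; have [phi phiD] := pdef _ pD.
by rewrite -phiD -extr -sat_rename; apply: cP; exists D, phi.
Qed.

(* Zorn's lemma on the partial tuples that are compatible with [p]. *)
Lemma realize V W (g : V -> C) (p : ((V + W -> C) -> Prop) -> Prop) :
  le_card V S -> le_card W S -> (forall D, p D -> definable D) ->
  (forall l, allP p l -> exists w, allP (fun D => D (join g w)) l) ->
  exists w, forall D, p D -> D (join g w).
Proof.
move=> VS WS pdef pfin; have [c0] := C0.
pose extends (G : set (W * C)) (w : W -> C) := forall x c, G (x, c) -> w x = c.
pose compatible (G : set (W * C)) := forall l, allP p l ->
  exists2 w, extends G w & allP (fun D => D (join g w)) l.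
have [F FP tot|G [Gc Gmax]] := @Zorn_bigcup _ compatible.
  move=> l pl; have [[A0 FA0]|F0] := EM (exists A, F A); last first.
    have [w wl] := pfin _ pl; exists w => // x c [A FA].
    by case: F0; exists A.
  have [lv lvP] := definable_list_supported (allP_imp pdef pl).
  pose G := (\bigcup_(A in F) A)%classic.
  have Gf x c c' : G (x, c) -> G (x, c') -> c = c'.
    move=> [A FA Axc] [B FB Bxc'].
    have [E FE [Exc Exc']] : exists2 E, F E & E (x, c) /\ E (x, c').
      by case: (tot _ _ FA FB) => AB; [exists B|exists A] => //; split=> //; exact: AB.
    by have [w we _] := FP _ FE [::] I; rewrite -(we _ _ Exc) -(we _ _ Exc').
  (* The support [lv] is finite, so one member of the chain contains all that [G] says about it. A
     solution for this member can be changed off [lv] to extend [G]. *)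
  have [A FA AP] : exists2 A, F A & allP (fun u : V + W =>
      if u is inr x then forall c, G (x, c) -> A (x, c) else True) lv.
    elim: lv {lvP} => [|u lv [A FA AP]] /=; first by exists A0.
    case: u => [v|x]; first by exists A.
    have [[c [B FB Bxc]]|nx] := EM (exists c, G (x, c)); last first.
      by exists A => //; split=> // c Gxc; case: nx; exists c.
    have Bx c' : G (x, c') -> B (x, c').
      by move=> Gxc'; rewrite (Gf _ _ _ Gxc' (_ : G (x, c))) //; exists B.
    case: (tot _ _ FA FB) => AB; [exists B|exists A] => //; split=> //.
      by apply: allP_imp AP => -[//|y] Ay c' /Ay; exact: AB.
    by move=> c' /Bx; exact: AB.
  have [w we wl] := FP _ FA _ pl.
  have /choice[w' w'P] x : exists c, (forall c', G (x, c') -> c = c') /\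
      ((forall c', ~ G (x, c')) -> c = w x).
    have [[c Gxc]|nx] := EM (exists c, G (x, c)).
      by exists c; split=> [c' /(Gf _ _ _ Gxc)//|/(_ c)].
    by exists (w x); split=> // c' Gxc'; case: nx; exists c'.
  exists w'; first by move=> x c Gxc; exact: (w'P x).1.
  apply: lvP wl; apply: allP_imp AP => -[//|x] Ax /=.
  have [[c Gxc]|nx] := EM (exists c, G (x, c)).
    by rewrite (we _ _ (Ax _ Gxc)) ((w'P x).1 _ Gxc).
  by rewrite (w'P x).2 // => c' Gxc'; apply: nx; exists c'.
have /choice[w wG] : forall x, exists c, G (x, c).
  apply: contrapT => /existsNP[x0 nx0].
  have Gx0 c : ~ G (x0, c) by move=> Gc'; apply: nx0; exists c.
  have /choice[f0 f0P] x : exists c, forall c', G (x, c') -> c = c'.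
    by have [w we _] := Gc [::] I; exists (w x) => c' /we.
  (* [rho] makes [x0] the variable to be realized and turns the coordinates already in [G] into
     parameters; the others are quantified away in [E l]. *)
  pose rho (u : V + W) : option (V + W) + W := match u with
    | inl v => inl (Some (inl v))
    | inr x => if pselect (x = x0) then inl None else
               if pselect (exists c, G (x, c)) then inl (Some (inr x)) else inr x end.
  pose E l (h : option (V + W) -> C) := exists w, allP (fun D => D (join h w \o rho)) l.
  have Edef l : allP p l -> definable (E l).
    move=> pl.
    apply: (definable_project (D := fun h => allP (fun D => D (h \o rho)) l)).
    apply: (definable_allP (D := fun D h => D (h \o rho))).
    by apply: allP_imp pl => D /pdef; exact: definable_comp.
  have [||c cP] := @realize_one _ (join g f0)
      (fun D => exists2 l, allP p l & D = E l) (small_sum VS WS).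
  - by move=> D [l pl ->]; exact: Edef.
  - move=> ls pls; have [l pl lE] : exists2 l, allP p l &
        forall h, E l h -> allP (fun D => D h) ls.
      elim: ls pls => [|D ls IH] /= => [_|[[l pl ->] /IH[l' pl' ll']]]; first by exists [::].
      exists (l ++ l'); first by apply/allP_cat.
      move=> h [w /allP_cat[wl wl']]; split; first by exists w.
      by apply: ll'; exists w.
    have [w we wl] := Gc _ pl; exists (w x0); apply: lE; exists w.
    have -> : join (ext (join g f0) (w x0)) w \o rho = join g w; last exact: wl.
    apply/funext => -[v|x] //=; case: pselect => [e|xx0] /=; first by rewrite e.
    by case: pselect => // -[c Gxc] /=; rewrite (f0P _ _ Gxc) (we _ _ Gxc).
  apply: (Gmax (fun q => G q \/ q = (x0, c))).
    by split=> [q Gq|/(_ (x0, c) (or_intror erefl)) /Gx0]; [left|].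
  move=> l pl; have [w wl] := cP _ (ex_intro2 _ _ l pl erefl).
  exists (fun x => (join (ext (join g f0) c) w \o rho) (inr x)).
    move=> x d [Gxd|[-> ->]] /=; last by case: pselect.
    case: pselect => [xx0|nx] /=; first by case: (Gx0 d); rewrite -xx0.
    by case: pselect => [ex|[]] /=; [exact: f0P|exists d].
  apply: allP_imp wl => D; congr (D _).
  by apply/funext => -[].
exists w => D pD; have [w' w'e /= [Dw' _]] := Gc [:: D] (conj pD I).
by suff -> : w = w' by []; apply/funext => x; rewrite (w'e _ _ (wG x)).
Qed.
End Realize.
End Definable.

(** * Types and chains of near tuples *)

Section SameType.
Variables (L : language) (C : structure L).

Lemma same_type_refl V (g : V -> C) : same_type g g.
Proof. by []. Qed.

Lemma same_type_sym V (g h : V -> C) : same_type g h -> same_type h g.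
Proof. by move=> gh phi; rewrite gh. Qed.

Lemma same_type_trans V (h g k : V -> C) : same_type g h -> same_type h k -> same_type g k.
Proof. by move=> gh hk phi; rewrite gh. Qed.

Lemma same_type_comp V W (f : W -> V) (g h : V -> C) :
  same_type g h -> same_type (g \o f) (h \o f).
Proof. by move=> gh phi; have := gh (rename phi f); rewrite !sat_rename. Qed.

Lemma same_type_sub V W (f : W -> V) (g h : V -> C) (g' h' : W -> C) :
  same_type g h -> (forall x, g' x = g (f x)) -> (forall x, h' x = h (f x)) -> same_type g' h'.
Proof.
move=> gh gg' hh'; have -> : g' = g \o f by apply/funext.
by have -> : h' = h \o f; [apply/funext|exact: same_type_comp].
Qed.

Lemma same_type_definable V (D : (V -> C) -> Prop) (g h : V -> C) :
  definable D -> same_type g h -> D g -> D h.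
Proof. by move=> [phi phiD] gh; rewrite -!phiD gh. Qed.
End SameType.

(* Extracts from [H : same_type g h] the equality of types of two subtuples,
   taken along the reindexing [f]. *)
Ltac subtype H f := apply: (same_type_sub (f := f) H); repeat case=> ?; try by [].

Lemma same_type_swap (L : language) (C : structure L) V W (a a' : V -> C) (b b' : W -> C) :
  same_type (join a b) (join a' b') -> same_type (join b a) (join b' a').
Proof.
move=> ab; subtype ab (fun u : W + V => match u with inl y => inr y | inr x => inl x end : V + W).
Qed.

Section Types.
Variables (L : language) (C : structure L).
Variables (K S : Type).
Hypotheses (C0 : inhabited C) (satC : saturated C K) (SK : lt_card S K).
Hypothesis (mulS : le_card (S * nat) S).

(** Type-definability without parameters: [R] is the intersection of the definable sets containing
    it. *)
Definition closed V (R : (V -> C) -> Prop) := forall g,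
  (forall D, definable D -> (forall h, R h -> D h) -> D g) -> R g.

Lemma closed_definable V (D : (V -> C) -> Prop) : definable D -> closed D.
Proof. by move=> dD g; apply. Qed.

Lemma closed_and V (R R' : (V -> C) -> Prop) :
  closed R -> closed R' -> closed (fun g => R g /\ R' g).
Proof.
move=> cR cR' g gP; split; [apply: cR|apply: cR'] => D dD RD; apply: gP => // h [Rh R'h];
  exact: RD.
Qed.

Lemma closed_all V X (R : X -> (V -> C) -> Prop) :
  (forall x, closed (R x)) -> closed (fun g => forall x, R x g).
Proof. by move=> cR g gP x; apply: cR => D dD RD; apply: gP => // h Rh; exact/RD/Rh. Qed.

Lemma closed_comp V W (R : (V -> C) -> Prop) (f : V -> W) :
  closed R -> closed (fun g : W -> C => R (g \o f)).
Proof.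
move=> cR g gP; apply: cR => D dD RD.
by apply: (gP (fun g => D (g \o f))); [exact: definable_comp|move=> h /RD].
Qed.

Lemma closed_iff V (R R' : (V -> C) -> Prop) :
  closed R -> (forall g, R g <-> R' g) -> closed R'.
Proof. by move=> cR RR'; suff -> : R' = R by []; apply/funext => g; apply/propext; rewrite RR'. Qed.

Lemma closed_same_type V W (f f' : W -> V) :
  closed (fun h : V -> C => same_type (h \o f) (h \o f')).
Proof.
apply: closed_all => phi; apply: closed_definable.
by apply: (definable_equiv (D := fun h => sat phi (h \o f)) (D' := fun h => sat phi (h \o f')));
  apply: definable_comp; exact: definable_sat.
Qed.

Lemma closed_type V (g : V -> C) : closed (same_type g).
Proof.
apply: closed_all => phi; apply: closed_definable.
have [gphi|gphi] := EM (sat phi g); last first.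
  apply: (definable_iff (definable_not (definable_sat C phi))) => h; tauto.
by apply: (definable_iff (definable_sat C phi)) => h; tauto.
Qed.

Lemma closed_same_type_inv V (R : (V -> C) -> Prop) g h :
  closed R -> same_type g h -> R g -> R h.
Proof.
move=> cR gh Rg; apply: cR => D dD RD; apply: same_type_definable dD gh _; exact: RD.
Qed.

(** Finitely many definable supersets of [R] project to a definable superset of the projection,
    which contains [g] by assumption. Saturation then finds one [w] for all of them. *)
Lemma closed_project V W (R : (V + W -> C) -> Prop) :
  le_card V S -> le_card W S -> closed R -> closed (fun g => exists w, R (join g w)).
Proof.
move=> VS WS cR g gP.
pose p (D : (V + W -> C) -> Prop) := definable D /\ forall h, R h -> D h.
have [||w wP] := realize C0 satC SK mulS (g := g) (p := p) VS WS.
- by move=> D [].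
- move=> l pl; apply: (gP (fun g => exists w, allP (fun D => D (join g w)) l)).
    apply: (definable_project C0 (D := fun h => allP (fun D => D h) l)).
    by apply: (definable_allP C0 (D := fun D => D)); apply: allP_imp pl => D [].
  by move=> h [w Rw]; exists w; apply: allP_imp pl => D [_]; apply.
- by exists w; apply: cR => D dD RD; exact: wP.
Qed.

(** Homogeneity for whole tuples: the tuples that extend to a realization of the type of (g, w) form
    a closed set, and closed sets are invariant under [same_type]. *)
Lemma extend_type V W (g g' : V -> C) (w : W -> C) :
  le_card V S -> le_card W S -> same_type g g' ->
  exists w', same_type (join g w) (join g' w').
Proof.
move=> VS WS gg'; have cR := closed_project VS WS (@closed_type _ (join g w)).
by apply: closed_same_type_inv cR gg' _; exists w.
Qed.

Section Near.
Variables (P : Type) (m : P -> C).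
Hypothesis (PS : le_card P S).

(** Letting [z] range over all realizations of the type of [m], instead of fixing [m], makes
    nearness depend only on the type of the pair (a, b). As [z] has bounded length, projection keeps
    chains closed. *)
Definition near V (a b : V -> C) :=
  exists z : P -> C, same_type m z /\ same_type (join a z) (join b z).

Fixpoint chain V n (a b : V -> C) : Prop :=
  if n is n'.+1 then exists c, near a c /\ chain n' c b else a = b.

Lemma near_same_type V (a b : V -> C) : near a b -> same_type a b.
Proof. by move=> [z [_ ab]]; subtype ab (@inl V P). Qed.

Lemma near_refl V (a : V -> C) : near a a.
Proof. by exists m. Qed.

Lemma near_sym V (a b : V -> C) : near a b -> near b a.
Proof. by move=> [z [mz ab]]; exists z; split=> //; exact: same_type_sym. Qed.

Lemma chain1 V (a b : V -> C) : near a b -> chain 1 a b.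
Proof. by move=> ab; exists b. Qed.

Lemma chain_cat V n k (b a c : V -> C) : chain n a b -> chain k b c -> chain (n + k) a c.
Proof.
elim: n a => [a -> //|n IH a [d [ad db]] bc] /=.
by exists d; split=> //; exact: IH.
Qed.

Lemma chain_sym V n (a b : V -> C) : chain n a b -> chain n b a.
Proof.
elim: n a b => [a b -> //|n IH a b [d [ad /IH bd]]].
by rewrite -addn1; apply: chain_cat bd _; apply/chain1/near_sym.
Qed.

Lemma chain_le V n k (a b : V -> C) : n <= k -> chain n a b -> chain k a b.
Proof.
move=> nk ab; rewrite -(subnKC nk); apply: chain_cat ab _.
by elim: (k - n) => //= i IH; exists b; split=> //; exact: near_refl.
Qed.

Lemma chain_same_type V n (a b : V -> C) : chain n a b -> same_type a b.
Proof.
elim: n a => [a -> //|n IH a [d [/near_same_type ad /IH db]]].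
exact: same_type_trans db.
Qed.

Lemma closed_near V : le_card V S ->
  closed (fun h : V + V -> C => near (h \o inl) (h \o inr)).
Proof.
move=> VS.
pose f1 (u : V + P) : V + V + P := match u with inl v => inl (inl v) | inr x => inr x end.
pose f2 (u : V + P) : V + V + P := match u with inl v => inl (inr v) | inr x => inr x end.
have cR : closed (fun u : V + V + P -> C =>
    same_type m (u \o inr) /\ same_type (u \o f1) (u \o f2)).
  apply: closed_and; last exact: closed_same_type.
  exact: (closed_comp (f := inr) (@closed_type _ m)).
apply: closed_iff (closed_project (small_sum mulS VS VS) PS cR) _ => h.
have E z : (join h z \o f1 = join (h \o inl) z) * (join h z \o f2 = join (h \o inr) z).
  by split; apply/funext => -[].
by split=> -[z []]; rewrite ?E => mz ab; exists z; rewrite ?E.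
Qed.

Lemma closed_chain V n : le_card V S ->
  closed (fun h : V + V -> C => chain n (h \o inl) (h \o inr)).
Proof.
move=> VS; elim: n => [|n IH].
  apply: (closed_iff (R := fun h => forall v, h (inl v) = h (inr v))).
    by apply: closed_all => v; apply: closed_definable; exact: definable_eq.
  by move=> h; split=> [e|/= e v]; [apply/funext|exact: (f_equal (fun f => f v) e)].
pose f1 (u : V + V) : V + V + V := match u with inl v => inl (inl v) | inr v => inr v end.
pose f2 (u : V + V) : V + V + V := match u with inl v => inr v | inr v => inl (inr v) end.
have cR := closed_and (closed_comp (f := f1) (@closed_near _ VS)) (closed_comp (f := f2) IH).
exact: (closed_project (small_sum mulS VS VS) VS cR).
Qed.

Lemma chain_inv V n (a b a' b' : V -> C) : le_card V S ->
  same_type (join a b) (join a' b') -> chain n a b -> chain n a' b'.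
Proof. by move=> VS ab; exact: closed_same_type_inv (@closed_chain _ n VS) ab. Qed.

(** If [u] and [u1] have the same type over [z], then [w] can be carried along over [z], and this
    [z] also witnesses that [w] is near its image. Thus a map moving [u] by a chain moves every
    further tuple by a chain of the same length. *)
Lemma extend_chain V W n (u u' : V -> C) (w : W -> C) :
  le_card V S -> le_card W S -> chain n u u' ->
  exists2 w', same_type (join u w) (join u' w') & chain n w w'.
Proof.
move=> VS WS; elim: n u w => [u w ->|n IH u w [u1 [[z [mz uu1]] u1u']]]; first by exists w.
have [w1 uw1] := extend_type w (small_sum mulS VS PS) WS uu1.
have [w' uw' ww'] := IH _ w1 u1u'; exists w'; last first.
  exists w1; split=> //; exists z; split=> //.
  by subtype uw1 (fun x : W + P => match x with inl v => inr v | inr x => inl (inr x) end : V + P + W).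
apply: same_type_trans uw'.
by subtype uw1 (fun x : V + W => match x with inl v => inl (inl v) | inr x => inr x end : V + P + W).
Qed.

(** The Tarski-Vaught test for the range of [n]. *)
Definition model_enum Q (n : Q -> C) := forall psi : formula L (option Q),
  (exists x, sat psi (ext n x)) -> exists q, sat psi (ext n (n q)).

Lemma model_enum_same_type Q (n n' : Q -> C) :
  same_type n n' -> model_enum n -> model_enum n'.
Proof.
move=> nn' nM psi [x sx].
have [|q sq] := nM psi; first by apply/(nn' (fex psi)); exists x.
exists q; pose f (o : option Q) := if o is Some v then v else q.
have E k : k \o f = ext k (k q) :> (_ -> C) by apply/funext => -[].
by move/(same_type_comp f): nn' => /(_ psi); rewrite !E => <-.
Qed.

Lemma model_enum_sat Q (n : Q -> C) V (s : V -> Q) (psi : formula L (option V)) :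
  model_enum n -> (exists x, sat psi (ext (n \o s) x)) ->
  exists q, sat psi (ext (n \o s) (n q)).
Proof.
have E x : ext n x \o omap s = ext (n \o s) x by apply/funext => -[].
move=> nM [x sx]; have [|q] := nM (rename psi (omap s)).
  by exists x; rewrite sat_rename E.
by rewrite sat_rename E => sq; exists q.
Qed.

Lemma model_enum_definable Q (n : Q -> C) V (s : V -> Q) (D : (option V -> C) -> Prop) :
  model_enum n -> definable D -> (exists x, D (ext (n \o s) x)) ->
  exists q, D (ext (n \o s) (n q)).
Proof.
move=> nM [phi phiD] [x]; rewrite -phiD => Dx.
by have [|q] := model_enum_sat (s := s) (psi := phi) nM; [exists x|exists q; rewrite -phiD].
Qed.
End Near.
End Types.

(** * Lascar distance *)

Section LascarGraph.
Variables (L : language) (C : structure L) (I : Type).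

Lemma lascar_adj_sym (a b : I -> C) : lascar_adj a b -> lascar_adj b a.
Proof.
move=> [ab [J [lt [s [sl sn si [i [j [ic jd]]]]]]]]; split; first by move/esym.
by exists J, lt, s; split=> //; exists j, i.
Qed.

Lemma dist_le_cat k l (a b c : I -> C) :
  dist_le k a b -> dist_le l b c -> dist_le (k + l) a c.
Proof.
elim: k a => [a -> //|k IH a [d [ad db]] bc]; exists d; split=> //; exact: IH.
Qed.

Lemma unbounded_far_pair (a : I -> C) : ~ d_bounded (lascar_class a) ->
  forall k, exists x y, [/\ lascar_eq a x, lascar_eq a y & ~ dist_le k x y].
Proof.
move=> unb k; apply: contrapT => nxy; apply: unb; exists k => x y ax ay.
split=> [_|xy]; last by exists k.
by apply: contrapT => nk; apply: nxy; exists x, y.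
Qed.

Lemma unbounded_two_points (a : I -> C) : ~ d_bounded (lascar_class a) ->
  exists c d : C, c <> d.
Proof.
move=> /unbounded_far_pair/(_ 0)[x [y [_ _ xy]]]; apply: contrapT => nC.
apply: xy; apply/funext => i; apply: contrapT => xyi.
by apply: nC; exists (x i), (y i).
Qed.
End LascarGraph.

Section LascarDistance.
Variables (L : language) (C : structure L).
Variables (K S : Type).
Hypotheses (C0 : inhabited C) (satC : saturated C K) (SK : lt_card S K).
Hypothesis (mulS : le_card (S * nat) S).
Variables (P I : Type) (m : P -> C).
Hypotheses (PS : le_card P S) (IS : le_card I S).

(* Among sufficiently many terms of an indiscernible sequence two agree on
   finitely many given formulas over [m]. *)
Lemma adj_near (a b : I -> C) : lascar_adj a b -> near m a b.
Proof.
move=> [ab [J [lt [s [[ltirr lttr lttot] [e ei] sind [i [j [sa sb]]]]]]]].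
pose f1 (u : I + P) : I + I + P := match u with inl v => inl (inl v) | inr x => inr x end.
pose f2 (u : I + P) : I + I + P := match u with inl v => inl (inr v) | inr x => inr x end.
have E (x y : I -> C) (z : P -> C) :
    (join (join x y) z \o f1 = join x z) * (join (join x y) z \o f2 = join y z).
  by split; apply/funext => -[].
pose p (D : (I + I + P -> C) -> Prop) :=
  (exists phi, D = fun u => sat phi m <-> sat phi (u \o inr)) \/
  (exists phi, D = fun u => sat phi (u \o f1) <-> sat phi (u \o f2)).
have pdef D : p D -> definable D.
  case=> -[phi ->]; last first.
    by apply: (@definable_equiv _ _ _ (fun u => sat phi (u \o f1)) (fun u => sat phi (u \o f2)));
      apply: definable_comp; exact: definable_sat.
  have d := definable_comp (inr : P -> I + I + P) (definable_sat C phi).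
  have [mphi|mphi] := EM (sat phi m); last first.
    by apply: (definable_iff (definable_not d)) => h; tauto.
  by apply: (definable_iff d) => h; tauto.
have [|z zP] := realize C0 satC SK mulS (g := join a b) (p := p) (small_sum mulS IS IS) PS pdef;
    last first.
  exists z; split=> phi.
    exact: (zP _ (or_introl (ex_intro _ phi erefl))).
  by have := zP _ (or_intror (ex_intro _ phi erefl)); rewrite !E.
(* [Q] is symmetric and, by indiscernibility, has one truth value on all increasing pairs of terms.
   So a single pair of distinct positions satisfying it suffices. *)
move=> l pl; pose Q (h : I + I -> C) := exists z, allP (fun D => D (join h z)) l.
have dQ : definable Q.
  apply: (definable_project C0 (D := fun h => allP (fun D => D h) l)).
  by apply: (definable_allP C0 (D := fun D => D)); apply: allP_imp pl.
have Qsym x y : Q (join x y) -> Q (join y x).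
  move=> [z zl]; exists z; elim: l pl zl {Q dQ} => //= D l IH [pD pl] [Dz zl].
  split; last exact: IH.
  by case: pD Dz => -[phi ->]; [exact|rewrite !E => h; exact: iff_sym].
have Qlt i1 j1 i2 j2 : lt i1 j1 -> lt i2 j2 -> Q (join (s i1) (s j1)) -> Q (join (s i2) (s j2)).
  move=> lt1 lt2; pose f k k' (o : 'I_2) : J := if o == ord0 then k else k'.
  have fP k k' : lt k k' -> forall o o' : 'I_2, o < o' -> lt (f k k' o) (f k k' o').
    by move=> kk' [[|[|[]]]//= ?] [[|[|[]]]//= ?].
  have H := sind 2 (f i1 j1) (f i2 j2) (fP _ _ lt1) (fP _ _ lt2).
  apply: same_type_definable dQ _.
  by subtype H (fun u : I + I => match u with inl x => (ord0, x) | inr x => (ord_max, x) end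
       : 'I_2 * I).
have [k [k' [kk' Qkk']]] : exists k k', k <> k' /\ Q (join (s (e k)) (s (e k'))).
  (* With [m] itself as the solution only the finitely many comparisons of the two terms remain, so
     equal truth values on [fs] are enough. *)
  have [fs fsP] : exists fs, forall x y,
      allP (fun phi : formula L (I + P) => sat phi (join x m) <-> sat phi (join y m)) fs ->
      allP (fun D => D (join (join x y) m)) l.
    elim: l pl {Q dQ Qsym Qlt} => [|D l IH] /= => [_|[[[phi ->]|[phi ->]] /IH[fs fsP]]].
    - by exists [::].
    - by exists fs => x y /fsP ?; split.
    - by exists (phi :: fs) => x y /= [xy /fsP ?]; split=> //; rewrite !E.
  pose bits k := [seq `[< sat phi (join (s (e k)) m) >] | phi <- fs].
  pose val k := [ffun i : 'I_(size fs) => nth false (bits k) i].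
  have [k [k' [kk' bkk']]] : exists k k', k <> k' /\ bits k = bits k'.
    apply: contrapT => nk; have : injective (fun k : 'I_(2 ^ size fs).+1 => val k).
      move=> k k' vkk'; apply: contrapT => kk'; apply: nk.
      exists k, k'; split; first by move=> /val_inj.
      apply: (@eq_from_nth _ false) => [|i0]; rewrite ?size_map // => i0fs.
      have := congr1 (fun g : {ffun 'I_(size fs) -> bool} => g (Ordinal i0fs)) vkk'.
      by rewrite !ffunE.
    by move/leq_card; rewrite card_ffun !card_ord card_bool ltnn.
  exists k, k'; split=> //; exists m; apply: fsP; rewrite /bits in bkk'.
  by elim: fs bkk' {val bits} => //= phi fs IH [e1 /IH]; split=> //; exact: asbool_eq_equiv e1.
have {kk'} [i' [j' [lt' Q']]] : exists i' j', lt i' j' /\ Q (join (s i') (s j')).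
  have [?|[/ei //|?]] := lttot (e k) (e k'); first by exists (e k), (e k').
  by exists (e k'), (e k); split=> //; exact: Qsym.
rewrite -/(Q (join a b)) -sa -sb.
have [lij|[ij|lji]] := lttot i j; first exact: Qlt lt' lij Q'.
  by case: ab; rewrite -sa -sb ij.
by apply: Qsym; exact: Qlt lt' lji Q'.
Qed.

(** Types over a model are finitely satisfiable in it. Only finitely many coordinates of [w] matter,
    and they are moved into the model one at a time. *)
Lemma model_tuple V (D : (V + P -> C) -> Prop) (p0 : P) : model_enum m ->
  definable D -> (exists w, D (join w m)) -> exists t : V -> P, D (join (m \o t) m).
Proof.
move=> mM dD; have [l lP] : exists l : seq V, forall g w w',
    allP (fun x => w x = w' x) l -> D (join w g) -> D (join w' g).
  have [l lP] := definable_supported dD.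
  exists (pmap (fun u : V + P => if u is inl x then Some x else None) l) => g w w' ww'.
  by apply: lP; elim: l ww' => //= -[x|v] l IH /= => [[? /IH]|/IH].
elim: l D dD lP => [|x0 l IH] D dD lP [w Dw]; first by exists (fun=> p0); exact: lP Dw.
pose upd (w : V -> C) c x := if pselect (x = x0) then c else w x.
pose f (u : V + P) : option P + V := match u with
  | inl x => if pselect (x = x0) then inl None else inr x
  | inr q => inl (Some q) end.
have Ef c w' g : join (ext g c) w' \o f = join (upd w' c) g.
  by apply/funext => -[v|x] //=; rewrite /upd; case: pselect.
have [q [w1]] : exists q, exists w1, D (join (ext (m \o id) (m q)) w1 \o f).
  apply: (model_enum_definable (D := fun h => exists w1, D (join h w1 \o f))) mM _ _.
    exact: (definable_project C0 (definable_comp f dD)).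
  exists (w x0), w; rewrite Ef; apply: lP Dw; apply: allP_all => x.
  by rewrite /upd; case: pselect => //= e; rewrite e.
rewrite Ef => Dw1.
pose h (u : V + P) : V + P := match u with
  | inl x => if pselect (x = x0) then inr q else inl x
  | inr q => inr q end.
have Eh w' g : join w' g \o h = join (upd w' (g q)) g.
  by apply/funext => -[v|x] //=; rewrite /upd; case: pselect.
have [||t Dt] := IH _ (definable_comp h dD).
- move=> g w2 w3 w23; rewrite !Eh /upd; apply: lP => /=.
  split; first by case: pselect.
  by apply: allP_imp w23 => x; case: pselect.
- by exists w1; rewrite Eh.
exists (fun x => if pselect (x = x0) then q else t x).
move: Dt; rewrite Eh; congr (D (join _ _)); apply/funext => x /=.
by rewrite /upd; case: pselect.
Qed.

Section Coheir.
Variables (U : set_system (I -> P)) (uU : UltraFilter U).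

(** The conditions holding of [m \o t] for [U]-almost all [t] are finitely satisfiable by such
    tuples. As [U] is an ultrafilter they form a complete type over [g], whence the equivalence. *)
Lemma ultra_average V (g : V -> C) : le_card V S -> exists c : I -> C,
  forall D, definable D -> (D (join g c) <-> U (fun t => D (join g (m \o t)))).
Proof.
move=> VS.
pose p (D : (V + I -> C) -> Prop) := definable D /\ U (fun t => D (join g (m \o t))).
have [||c cP] := realize C0 satC SK mulS (g := g) (p := p) VS IS.
- by move=> D [].
- move=> l pl; suff /filter_ex[t tl] : U (fun t => allP (fun D => D (join g (m \o t))) l).
    by exists (m \o t).
  elim: l pl => /= [_|D l IH [[_ UD] /IH Ul]]; first exact: filterT.
  exact: filterI UD Ul.
- exists c => D dD; split=> [Dc|UD]; last exact: cP.
  have [//|nUD] := in_ultra_setVsetC (fun t : I -> P => D (join g (m \o t))) uU.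
  have /cP // : p (fun h => ~ D h) by split=> //; exact: definable_not.
Qed.

Definition uncurry J (h : J -> I -> C) (u : J * I) := h u.1 u.2.

Lemma coheir_sequence (a b : I -> C) : exists r : nat -> I -> C,
  [/\ r 0 = a, r 1 = b & forall k, 1 < k -> exists h : nat -> I -> C,
    (forall j, j < k -> h j = r j) /\ forall D, definable D ->
      (D (join (join m (uncurry h)) (r k)) <->
       U (fun t => D (join (join m (uncurry h)) (m \o t))))].
Proof.
have VS : le_card (P + nat * I) S.
  by apply: small_sum => //; apply: small_mul => //; exact: le_card_refl.
have /choice[next nextP] (h : nat -> I -> C) :=
  ultra_average (join m (uncurry h)) VS.
(* [l n] lists the first n + 2 terms. [next] expects an infinite sequence, so the list is padded
   with [a]. *)
pose l n := iter n (fun l => rcons l (next (nth a l))) [:: a; b].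
have ls n : size (l n) = n.+2 by elim: n => //= n IH; rewrite size_rcons IH.
have ln n k j : j < n.+2 -> nth a (l (n + k)) j = nth a (l n) j.
  move=> jn; elim: k => [|k IH]; first by rewrite addn0.
  by rewrite addnS /= nth_rcons ls -IH (leq_trans jn) // !ltnS leq_addr.
exists (fun k => nth a (l k) k); split=> // -[|[|k]] // _.
exists (nth a (l k)); split=> [j jk|D dD].
  case: (leqP j k) => jk'; first by rewrite -(subnKC jk') ln.
  have /eqP-> : j == k.+1 by rewrite eqn_leq jk' -ltnS jk.
  by rewrite -[k.+1]addn1 ln // addn1.
rewrite -addn1 ln; last by rewrite addn1.
by rewrite addn1 /= nth_rcons ls ltnn eqxx; exact: nextP.
Qed.

(* Peeling off the last term turns a formula about [n.+1] terms into the
   [U]-average of formulas about [n] terms. *)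
Lemma coheir_indiscernible (r : nat -> I -> C) :
  (forall k, k < 2 -> forall D, definable D ->
     (D (join m (r k)) <-> U (fun t => D (join m (m \o t))))) ->
  (forall k, 1 < k -> exists h : nat -> I -> C,
    (forall j, j < k -> h j = r j) /\ forall D, definable D ->
      (D (join (join m (uncurry h)) (r k)) <->
       U (fun t => D (join (join m (uncurry h)) (m \o t))))) ->
  forall n (i j : 'I_n -> nat),
    (forall k k' : 'I_n, k < k' -> i k < i k') -> (forall k k' : 'I_n, k < k' -> j k < j k') ->
    (forall k : 'I_n, 0 < k -> 1 < i k) -> (forall k : 'I_n, 0 < k -> 1 < j k) ->
  forall D, definable D ->
    (D (join m (uncurry (r \o i))) <-> D (join m (uncurry (r \o j)))).
Proof.
move=> r01 r2; elim=> [|n IH] i j imono jmono i2 j2 D dD.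
  suff -> : uncurry (r \o i) = uncurry (r \o j) by [].
  by apply/funext => -[[]].
pose glue (s : 'I_n -> I -> C) (c : I -> C) (u : 'I_n.+1 * I) :=
  if unlift ord_max u.1 is Some k then s k u.2 else c u.2.
have peel (e : 'I_n.+1 -> nat) : (forall k k' : 'I_n.+1, k < k' -> e k < e k') ->
    (forall k : 'I_n.+1, 0 < k -> 1 < e k) ->
    (D (join m (uncurry (r \o e))) <->
     U (fun t => D (join m (glue (r \o (e \o lift ord_max)) (m \o t))))).
  move=> emono e2.
  have Er : uncurry (r \o e) = glue (r \o (e \o lift ord_max)) (r (e ord_max)).
    by apply/funext => -[k x]; rewrite /glue /uncurry /=; case: unliftP => [k'|] ->.
  rewrite Er; have [ke|ek] := ltnP 1 (e ord_max).
    have [h [hr hP]] := r2 _ ke.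
    pose f (u : P + 'I_n.+1 * I) : P + nat * I + I := match u with
      | inl p => inl (inl p)
      | inr (k, x) => if unlift ord_max k is Some k' then inl (inr (e (lift ord_max k'), x))
                      else inr x end.
    have Ef c : join (join m (uncurry h)) c \o f = join m (glue (r \o (e \o lift ord_max)) c).
      apply/funext => -[//|[k x]]; rewrite /glue /=; case: unliftP => //= k' _.
      by rewrite /uncurry /= hr //; apply: emono; rewrite lift_max.
    have := hP _ (definable_comp f dD); rewrite Ef => ->.
    by under eq_fun do rewrite Ef.
  (* The last position has an index below 2, which only position 0 may have. *)
  have n0 : n = 0 by case: n {IH D dD glue Er emono i j imono jmono i2 j2} e e2 ek => // n e e2; rewrite leqNgt e2.
  pose f (u : P + 'I_n.+1 * I) : P + I := match u with
    | inl p => inl p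
    | inr (k, x) => inr x end.
  have Ef c : join m c \o f = join m (glue (r \o (e \o lift ord_max)) c).
    apply/funext => -[//|[k x]]; rewrite /glue /=; case: unliftP => //= k'.
    by have := ltn_ord k'; rewrite {2}n0.
  have := r01 _ ek _ (definable_comp f dD); rewrite Ef => ->.
  by under eq_fun do rewrite Ef.
rewrite !peel //.
suff E t : D (join m (glue (r \o (i \o lift ord_max)) (m \o t))) =
    D (join m (glue (r \o (j \o lift ord_max)) (m \o t))).
  by under eq_fun do rewrite E.
apply/propext.
(* The peeled term is now the tuple [m \o t] of the model, hence a parameter, and [n] terms are
   left. *)
pose f (u : P + 'I_n.+1 * I) : P + 'I_n * I := match u with
  | inl p => inl p
  | inr (k, x) => if unlift ord_max k is Some k' then inr (k', x) else inl (t x) end.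
have Ef s : join m (uncurry s) \o f = join m (glue s (m \o t)).
  by apply/funext => -[//|[k x]]; rewrite /glue /=; case: unliftP.
rewrite -!Ef; apply: IH (definable_comp f dD) => [k k' kk'|k k' kk'|k k0|k k0].
- by apply: imono; rewrite !lift_max.
- by apply: jmono; rewrite !lift_max.
- by apply: i2; rewrite lift_max.
- by apply: j2; rewrite lift_max.
Qed.
End Coheir.

(* Both [a] and [b] extend the same Morley sequence of a coheir. *)
Lemma same_type_dist (p0 : P) (a b : I -> C) : model_enum m ->
  same_type (join a m) (join b m) -> dist_le 2 a b.
Proof.
move=> mM ab.
(* [F] is generated by the type of [a] over [m], and [model_tuple] makes it proper. The average over
   [m] of an ultrafilter above it is this type, so both [a] and [b] realize the average. *)
pose F (A : set (I -> P)) := exists2 D, definable D /\ D (join a m) &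
  forall t, D (join (m \o t) m) -> A t.
have FF : ProperFilter F.
  apply: Build_ProperFilter; last first.
    split=> [|A B [D [dD Da] DA] [D' [dD' Da'] DB]|A B AB [D DP DA]].
    - by exists (fun _ => True) => //; split=> //; exact: definable_true.
    - exists (fun h => D h /\ D' h); first by split=> //; exact: definable_and.
      by move=> t [/DA At /DB Bt].
    - by exists D => // t /DA; exact: AB.
  move=> [D [dD Da] D0]; have [|t Dt] := model_tuple p0 mM dD; first by exists a.
  exact: D0 Dt.
have [U [uU FU]] := ultraFilterLemma FF.
pose sw (u : P + I) : I + P := match u with inl p => inr p | inr x => inl x end.
have aU (c : I -> C) : same_type (join c m) (join a m) -> forall D, definable D ->
    (D (join m c) <-> U (fun t => D (join m (m \o t)))).
  move=> ca D dD.
  have E' d : join m d = join d m \o sw by apply/funext => -[].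
  have dD' := definable_comp sw dD.
  have FD D' : definable D' -> D' (join a m) -> U (fun t => D' (join (m \o t) m)).
    by move=> dD'' D'a; apply: FU; exists D'.
  rewrite E'; under eq_fun do rewrite E'.
  split=> [Dc|UD]; first exact: (FD _ dD' (same_type_definable dD' ca Dc)).
  apply: contrapT => nDc; have := same_type_definable (definable_not dD') ca nDc.
  move/(FD _ (definable_not dD')) => UnD.
  have UF : Filter U := @filter_filter _ _ (@ultra_proper _ _ uU).
  have UDn := @filterI _ _ UF _ _ UD UnD.
  by have [t []] := filter_ex UDn.
have [r [r0 r1 r2]] := coheir_sequence uU a b.
have rind := coheir_indiscernible (U := U) _ r2.
have {rind} rind n (i j : 'I_n -> nat) :
    (forall k k' : 'I_n, k < k' -> i k < i k') -> (forall k k' : 'I_n, k < k' -> j k < j k') ->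
    (forall k : 'I_n, 0 < k -> 1 < i k) -> (forall k : 'I_n, 0 < k -> 1 < j k) ->
    same_type (uncurry (r \o i)) (uncurry (r \o j)).
  move=> im jm i2 j2 phi.
  apply: (rind _ n i j im jm i2 j2 _ (definable_comp inr (definable_sat C phi))).
  case=> [_|[_|//]]; first by rewrite r0; apply: aU.
  by rewrite r1; apply: aU; exact: same_type_sym.
have adj (e : nat) c : e < 2 -> r e = c -> c <> r 2 -> lascar_adj c (r 2).
  move=> e2 re c2; split=> //.
  (* The sequence [r e], [r 2], [r 3], ... keeps only one of the first two terms, as [rind]
     requires. *)
  pose f k := if k is k'.+1 then k'.+2 else e.
  have fmono k k' : k < k' -> f k < f k' by case: k k' => [|k] [|k'] //=; exact: leq_trans.
  exists nat, (fun i j => i < j), (r \o f); split.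
  - split=> [x|x y z|x y]; [by rewrite ltnn|exact: ltn_trans|].
    by case: (ltngtP x y) => [?|?|->]; [left|right; right|right; left].
  - by exists id.
  - move=> n i j im jm; apply: (rind n (f \o i) (f \o j)).
    + by move=> k k' /im; exact: fmono.
    + by move=> k k' /jm; exact: fmono.
    + move=> k k0 /=; have := im (Ordinal (leq_ltn_trans (leq0n k) (ltn_ord k))) k k0.
      by case: (i k).
    + move=> k k0 /=; have := jm (Ordinal (leq_ltn_trans (leq0n k) (ltn_ord k))) k k0.
      by case: (j k).
  - by exists 0, 1.
(* The common third term is the midpoint. Adjacency requires distinct tuples, so either step may
   degenerate to an equality. *)
exists (r 2); split.
  by have [->|ne] := EM (a = r 2); [left|right; exact: (adj 0)].
exists b; split=> //; have [->|ne] := EM (b = r 2); [by left|right].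
by apply: lascar_adj_sym; exact: (adj 1).
Qed.
End LascarDistance.

(** * Models *)

(* Takes the place of [formula L nat], which lives in a universe too large for
   indexing variables. *)
Definition definable_set (L : language) (C : structure L) := {D : (nat -> C) -> Prop | definable D}.

Section Models.
Variables (L : language) (C : structure L).
Variables (K S : Type).
Hypotheses (C0 : inhabited C) (satC : saturated C K) (SK : lt_card S K).
Hypothesis (mulS : le_card (S * nat) S).
Variables (P : Type) (p0 p1 : P).
Hypotheses (p01 : p0 <> p1) (formP : le_card (definable_set C) P).
Hypotheses (powP : le_card (nat -> P) P) (PS : le_card P S).

(** Skolem closure: each stage adds a witness for every pair of a definable set in countably many
    variables and a sequence of parameters. By [formP] and [powP] there are at most |P| such pairs,
    so [P] indexes every stage and the union. Variable 0 is the one to be witnessed. *)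
Lemma exists_model X (t : X -> C) (x0 : X) : le_card X P ->
  exists n : P -> C, model_enum n /\ forall x, exists q, n q = t x.
Proof.
move=> XP; pose F := definable_set C.
have [eX eXs] := le_card_surj x0 XP.
have [dec decs] : exists g : P -> P + F * (nat -> P), forall x, exists y, g y = x.
  apply: (le_card_surj (inl p0)).
  apply: (le_card_sum_pow p01 powP); first exact: le_card_refl.
  exact: (le_card_prod_pow powP).
have [dec2 dec2s] : exists g : P -> nat * P, forall x, exists y, g y = x.
  apply: (le_card_surj (0, p0)); apply: (le_card_prod_pow powP); last exact: le_card_refl.
  exact: le_card_nat_pow p01 powP.
pose scons (x : C) (g : nat -> C) k := if k is k'.+1 then g k' else x.
have /choice[sk skP] (u : F * (nat -> C)) : exists c,
    (exists x, sval u.1 (scons x u.2)) -> sval u.1 (scons c u.2).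
  have [c0] := C0; have [[x sx]|nx] := EM (exists x, sval u.1 (scons x u.2)).
    by exists x.
  by exists c0.
pose stage := fix stage k : P -> C := if k is k'.+1 then
  fun p => match dec p with
    | inl y => stage k' y
    | inr (D, y) => sk (D, stage k' \o y) end else t \o eX.
have lift k k' : k <= k' -> exists f : P -> P, forall p, stage k' (f p) = stage k p.
  elim: k' => [|k' IH]; first by rewrite leqn0 => /eqP->; exists id.
  rewrite leq_eqVlt => /predU1P[->|/IH[f fP]]; first by exists id.
  have /choice[g gP] p : exists y, dec y = inl p by exact: decs.
  by exists (g \o f) => p /=; rewrite gP fP.
pose n p := stage (dec2 p).1 (dec2 p).2.
have nE k p : exists q, n q = stage k p.
  by have [q qE] := dec2s (k, p); exists q; rewrite /n qE.
exists n; split; last first.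
  by move=> x; have [y <-] := eXs x; exact: (nE 0 y).
move=> psi [x sx]; have [l lP] := formula_support psi.
(* A formula over the union uses finitely many coordinates. [e] codes them as numbers, with 0 for
   the bound variable, and a single stage [k] contains the values of the others. *)
have [e [k [y eP]]] : exists (e : option P -> nat) k (y : nat -> P),
    allP (fun o => forall c, ext n c o = scons c (stage k \o y) (e o)) l.
  elim: l {lP} => [|o l [e [k [y eP]]]]; first by exists (fun=> 0), 0, (fun=> p0).
  case: o => [p|]; last first.
    exists (fun o => if o is Some _ then e o else 0), k, y; split=> //.
    by apply: allP_imp eP => -[].
  have [f fP] := lift _ _ (leq_maxl k (dec2 p).1).
  have [g gP] := lift _ _ (leq_maxr k (dec2 p).1).
  exists (fun o => if pselect (o = Some p) then 1 else if e o is i.+1 then i.+2 else 0).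
  exists (maxn k (dec2 p).1), (fun i => if i is i'.+1 then f (y i') else g (dec2 p).2).
  split=> [c|]; first by case: pselect => //= _; rewrite gP.
  apply: allP_imp eP => o eP c; case: pselect => [oE|nE1] /=; first by rewrite oE /= gP.
  by rewrite eP; case: (e o) => //= i; rewrite fP.
have sE c : sat psi (ext n c) <-> sat (rename psi e) (scons c (stage k \o y)).
  by rewrite sat_rename; apply: lP; apply: allP_imp eP => o ->.
pose D : F := exist _ _ (definable_sat C (rename psi e)).
have [p pE] := decs (inr (D, y)); have [q qE] := nE k.+1 p.
exists q; rewrite sE qE /= pE; apply: (skP (D, _)); exists x; exact/sE.
Qed.

Lemma model_enum_elementary Q (n : Q -> C) :
  model_enum n -> elementary_sub (fun x => exists q, n q = x).
Proof.
move=> nM.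
have h : closed_sub (fun x => exists q, n q = x).
  move=> f args /choice[g gP].
  have [|q /= qE] := model_enum_sat (s := g)
      (psi := feq (tvar L None) (tapp (fun i => tvar L (Some i)))) nM.
    by exists (ifun (n \o g)).
  by exists q; rewrite qE; congr ifun; apply/funext => i /=.
exists h => V phi; pose val (x : induced h) : C := sval x.
have evalE W (t : term L W) (s : W -> induced h) : val (eval s t) = eval (val \o s) t.
  elim: t => //= f args IH; congr ifun; apply/funext => i; exact: IH.
elim: phi => {V} [V t1 t2|V r args|V psi IH|V p2 IH1 p3 IH2|V psi IH] s /=.
- split=> e; first by have := congr1 val e; rewrite !evalE.
  by apply: sval_inj; rewrite -!/(val _) !evalE.
- suff -> : (fun i => val (eval (M := induced h) s (args i))) = (fun i => eval (val \o s) (args i)) by [].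
  by apply/funext => i; exact: evalE.
- by rewrite IH.
- by rewrite IH1 IH2.
have extE (x : induced h) : (fun o => sval (ext (s : V -> induced h) x o)) = ext (fun v => sval (s v)) (sval x).
  by apply/funext => -[].
split=> [[x]|]; first by rewrite IH extE => sx; exists (sval x).
have /choice[g gP] v : exists q, n q = sval (s v) by exact: (svalP (s v)).
have <- : n \o g = (fun v => sval (s v)) by apply/funext.
move/(model_enum_sat nM) => [q sq]; exists (exist _ (n q) (ex_intro _ q erefl)).
by rewrite IH extE /=; have <- : n \o g = (fun v => sval (s v)) by apply/funext.
Qed.

Section InvariantModel.
Variables (J : Type) (m : P -> C) (h : J -> P -> C).
Hypotheses (Jnat : le_card J nat) (mh : forall j, same_type m (h j)).

(* Each stage is a model containing the images of the previous one under all
   the maps, which extend by homogeneity. *)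
Lemma invariant_model : exists (n : nat * P -> C) (pi : J -> nat * P -> nat * P)
    (iota : P -> nat * P),
  [/\ model_enum n, forall j, same_type n (n \o pi j),
      n \o iota = m & forall j, n \o pi j \o iota = h j].
Proof.
(* A state is an enumeration together with its images under all the maps. *)
pose state := {s : (P -> C) * (J -> P -> C) | forall j, same_type s.1 (s.2 j)}.
have /choice[next nextP] (s : state) : exists u : state * ((P -> P) * (J -> P -> P)),
    [/\ model_enum (sval u.1).1,
        (sval u.1).1 \o u.2.1 = (sval s).1,
        forall j, (sval u.1).2 j \o u.2.1 = (sval s).2 j &
        forall j, (sval u.1).1 \o u.2.2 j = (sval s).2 j].
  case: s => [[t tj] /= ttj].
  have JP : le_card J P by apply: le_card_trans Jnat _; exact: le_card_nat_pow p01 powP.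
  have [|n [nM nP]] := exists_model (join t (uncurry tj)) (inl p0).
    apply: (le_card_sum_pow p01 powP); first exact: le_card_refl.
    by apply: (le_card_prod_pow powP) => //; exact: le_card_refl.
  have /choice[al alP] p : exists q, n q = t p by exact: (nP (inl p)).
  have /choice[be beP] (u : J * P) : exists q, n q = tj u.1 u.2 by exact: (nP (inr u)).
  (* The equalities [n (al p) = t p] belong to the type copied here, so the new images extend the
     old ones. *)
  have /choice[nj njP] j := extend_type C0 satC SK mulS n PS PS (ttj j).
  have nnj j : same_type n (nj j) by subtype (njP j) (@inr P P).
  exists (exist _ (n, nj) nnj, (al, fun j p => be (j, p))); split=> //= [|j|j].
  - exact/funext.
  - apply/funext => p /=.
    have := same_type_definable (definable_eq C (inr (al p)) (inl p)) (njP j).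
    by move=> /= ->.
  - by apply/funext => p /=; rewrite beP.
pose st i := iter i (fun s => (next s).1) (exist _ (m, h) mh : state).
have lift i i' : i <= i' -> exists f : P -> P, forall p,
    (sval (st i')).1 (f p) = (sval (st i)).1 p /\
    forall j, (sval (st i')).2 j (f p) = (sval (st i)).2 j p.
  elim: i' => [|i' IH]; first by rewrite leqn0 => /eqP->; exists id.
  rewrite leq_eqVlt => /predU1P[->|/IH[f fP]]; first by exists id.
  have [_ E1 E2 _] := nextP (st i'); exists ((next (st i')).2.1 \o f) => p.
  have [<- Ej] := fP p; split=> [|j]; first by rewrite -E1.
  by rewrite -Ej -E2.
have /choice[f fP] (u : nat * nat) : exists f : P -> P, u.1 <= u.2 -> forall p,
    (sval (st u.2)).1 (f p) = (sval (st u.1)).1 p /\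
    forall j, (sval (st u.2)).2 j (f p) = (sval (st u.1)).2 j p.
  by have [/lift[f fP]|] := boolP (u.1 <= u.2); [exists f|exists id].
pose n (u : nat * P) := (sval (st u.1)).1 u.2.
(* The images of one stage are only sure to be enumerated in the next, so [pi] raises the level by
   one. *)
pose pi j (u : nat * P) : nat * P := (u.1.+1, (next (st u.1)).2.2 j u.2).
have nstE j u : n (pi j u) = (sval (st u.1)).2 j u.2.
  by have [_ _ _ E] := nextP (st u.1); rewrite -E.
(* Finitely many indices fold into one common stage compatibly with all the maps, which reduces each
   formula to that stage. *)
pose fold i0 (u : nat * P) := f (u.1, i0) u.2.
have foldP i0 u : u.1 <= i0 -> n u = (sval (st i0)).1 (fold i0 u) /\
    forall j, n (pi j u) = (sval (st i0)).2 j (fold i0 u).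
  by move=> /(fP (_, _))/(_ u.2)[E1 E2]; split=> [|j]; rewrite ?nstE.
have bounded X (e : X -> nat) (l : seq X) : exists i0, allP (fun x => e x <= i0) l.
  elim: l => [|x l [i0 lP]]; first by exists 0.
  exists (maxn (e x) i0); split; first exact: leq_maxl.
  by apply: allP_imp lP => y yi; exact: leq_trans yi (leq_maxr _ _).
exists n, pi, (pair 0); split=> //.
- move=> psi [x sx]; have [l lP] := formula_support psi.
  have [i0 l0] := bounded _ (fun o : option (nat * P) => if o is Some u then u.1 else 0) l.
  have E c : sat psi (ext n c) <-> sat psi (ext ((sval (st i0.+1)).1 \o fold i0.+1) c).
    apply: lP; apply: allP_imp l0 => -[u|] //= ui.
    by have [] := foldP i0.+1 u (leqW ui).
  have [M _ _ _] := nextP (st i0).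
  have [|q sq] := @model_enum_sat _ _ _ _ _ (fold i0.+1) psi M.
    by exists x; exact/E.
  by exists (i0.+1, q); apply/E.
- move=> j phi; have [l lP] := formula_support phi.
  have [i0 l0] := bounded _ fst l.
  rewrite (lP _ _ ((sval (st i0)).1 \o fold i0)); last first.
    by apply: allP_imp l0 => u /foldP[].
  rewrite (lP _ (n \o pi j) ((sval (st i0)).2 j \o fold i0)); last first.
    by apply: allP_imp l0 => u /foldP[_ E]; exact: E.
  exact: (same_type_comp (fold i0) (svalP (st i0) j)).
- by move=> j; apply/funext => p; rewrite /= nstE.
Qed.
End InvariantModel.
End Models.

(** * Recurrent types *)

Section Recurrence.
Variables (L : language) (C : structure L).
Variables (K S : Type).
Hypotheses (C0 : inhabited C) (satC : saturated C K) (SK : lt_card S K).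
Hypothesis (mulS : le_card (S * nat) S).
Variables (P I : Type) (m : P -> C).
Hypotheses (PS : le_card P S) (IS : le_card I S).

Definition unbounded_chain (a : I -> C) :=
  forall k, exists b, (exists l, chain m l a b) /\ ~ chain m k a b.

Lemma unbounded_chain_same_type (a b : I -> C) :
  same_type a b -> unbounded_chain a -> unbounded_chain b.
Proof.
move=> ab ua k; have [c [[l acl] ack]] := ua k.
have [c' acbc'] := extend_type C0 satC SK mulS c IS IS ab.
have inv := chain_inv C0 satC SK mulS PS IS.
exists c'; split; first by exists l; exact: inv acbc' acl.
by move=> bck; apply: ack; apply: inv bck; exact: same_type_sym.
Qed.

(* [h] acts as a Lascar strong automorphism; for a single [x] some [h] moves
   [x] far because its class is unbounded, and compactness over [m] makes
   finitely many [h] suffice. *)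
Lemma separating_maps (a : I -> C) k : unbounded_chain a ->
  exists hs : seq (P -> C), allP (fun h => exists l, chain m l m h) hs /\
    forall b, same_type a b -> exists i, forall b',
      same_type (join b' m) (join b (nth m hs i)) -> ~ chain m k b b'.
Proof.
move=> ua; pose PI := (P + I)%type.
have PIS : le_card PI S by exact: small_sum.
(* For u = (m', x) and w = (h', x'): some copy h' of [h] over m' is such that the map from h' to m'
   takes [x] to an x' within distance [k]. Quantifying over copies makes this closed without
   parameters, so compactness applies. *)
pose moved h (u : PI -> C) := exists w : PI -> C,
  [/\ same_type (join m h) (join (u \o inl) (w \o inl)),
      same_type (join (w \o inr) (u \o inl)) (join (u \o inr) (w \o inl)) &
      chain m k (u \o inr) (w \o inr)].
have cmoved h : closed (moved h).
  pose f1 (u : P + P) : PI + PI := match u with inl p => inl (inl p) | inr p => inr (inl p) end.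
  pose f2 (u : I + P) : PI + PI := match u with inl p => inr (inr p) | inr p => inl (inl p) end.
  pose f3 (u : I + P) : PI + PI := match u with inl p => inl (inr p) | inr p => inr (inl p) end.
  pose f4 (u : I + I) : PI + PI := match u with inl p => inl (inr p) | inr p => inr (inr p) end.
  have cR := closed_and (closed_comp (f := f1) (@closed_type _ _ _ (join m h)))
    (closed_and (@closed_same_type _ C _ _ f2 f3)
                (closed_comp (f := f4) (@closed_chain _ _ _ _ C0 satC SK mulS _ m PS I k IS))).
  apply: closed_iff (closed_project C0 satC SK mulS PIS PIS cR) _ => u.
  have E w : [/\ join u w \o f1 = join (u \o inl) (w \o inl),
      join u w \o f2 = join (w \o inr) (u \o inl) &
      join u w \o f3 = join (u \o inr) (w \o inl)].
    by split; apply/funext => -[].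
  split=> [[w [wm [wt wc]]]|[w [wm wt wc]]]; exists w; have [E1 E2 E3] := E w.
    by rewrite E1 in wm; rewrite E2 E3 in wt; split.
  by split; [rewrite E1|split; [rewrite E2 E3|]].
pose p (D : (PI -> C) -> Prop) := definable D /\
  ((forall x, same_type a x -> D (join m x)) \/
   exists h, (exists l, chain m l m h) /\ forall u, moved h u -> D u).
have [fin|/existsNP[l /not_implyP[pl nl]]] := EM (forall l, allP p l ->
    exists x, allP (fun D => D (join m x)) l).
  exfalso.
  have [x xP] := realize C0 satC SK mulS PS IS (fun D (pD : p D) => pD.1) fin.
  have ax : same_type a x.
    apply: closed_type => D dD aD.
    apply: (xP (fun u => D (u \o inr))); split; first exact: definable_comp.
    by left=> y /aD.
  (* The constant 3 comes from the path x, x1, w1, x2, y: the step from [x1] to [w1] costs [k] and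
     the other three cost 1. Here [h] is chosen so that the map from [h] to [m] takes [x] to [y],
     and [x2] is the image of [x1] under it. *)
  have [y [[n xyn] xyk]] := unbounded_chain_same_type ax ua k.+3.
  have [h xhym mh] := extend_chain C0 satC SK mulS PS m IS PS (chain_sym xyn).
  have [|w [/= mhh' wx kxw]] := cmoved h (join m x).
    move=> D dD hD; apply: xP; split=> //; right; exists h; split=> //.
    by exists n.
  have [x1w1 xt] := extend_type C0 satC SK mulS (join x (w \o inr))
    (small_sum mulS PS PS) (small_sum mulS IS IS) (same_type_sym mhh').
  pose x1 := x1w1 \o inl; pose w1 := x1w1 \o inr.
  have xx1 : chain m 1 x x1.
    apply/chain1; exists m; split; first exact: same_type_refl.
    by subtype xt (fun u : I + P => match u with inl v => inr (inl v) | inr q => inl (inl q) end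
      : (P + P) + (I + I)).
  have x1w1k : chain m k x1 w1.
    apply: (chain_inv C0 satC SK mulS PS IS) kxw.
    by subtype xt (fun u : I + I => inr u : (P + P) + (I + I)).
  have w1h : same_type (join w1 m) (join x1 h).
    have E1 : same_type (join (w \o inr) m) (join w1 m).
      by subtype xt (fun u : I + P => match u with inl v => inr (inr v) | inr q => inl (inl q) end
        : (P + P) + (I + I)).
    have E2 : same_type (join x (w \o inl)) (join x1 h).
      by subtype xt (fun u : I + P => match u with inl v => inr (inl v) | inr q => inl (inr q) end
        : (P + P) + (I + I)).
    exact: same_type_trans (same_type_sym E1) (same_type_trans wx E2).
  have [x2 x2t] := extend_type C0 satC SK mulS x1 (small_sum mulS IS PS) IS (same_type_sym xhym).
  have yx2 : chain m 1 x2 y.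
    apply: (chain_inv C0 satC SK mulS PS IS) (chain_sym xx1).
    by subtype x2t (fun u : I + I => match u with inl v => inr v | inr v => inl (inl v) end
      : (I + P) + I).
  have w1x2 : chain m 1 w1 x2.
    apply/chain1; exists m; split; first exact: same_type_refl.
    apply: same_type_trans w1h _.
    by subtype x2t (fun u : I + P => match u with inl v => inr v | inr q => inl (inr q) end
      : (I + P) + I).
  apply: xyk; have := chain_cat xx1 (chain_cat x1w1k (chain_cat w1x2 yx2)).
  by rewrite add1n addn2.
have [hs [hsm hsP]] : exists hs : seq (P -> C), allP (fun h => exists l, chain m l m h) hs /\
    forall x, same_type a x -> (forall i, moved (nth m hs i) (join m x)) ->
      allP (fun D => D (join m x)) l.
  elim: l pl {nl} => [|D l IH] /= => [_|[[dD pD] /IH[hs [hsm hsP]]]].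
    by exists [::].
  case: pD => [aD|[h [hm hD]]].
    by exists hs; split=> // x ax xhs; split; [exact: aD|exact: hsP].
  exists (h :: hs); split=> // x ax xhs; split; first exact: hD (xhs 0).
  by apply: hsP => // i; exact: (xhs i.+1).
exists hs; split=> // b ab.
have /existsNP[i ni] : ~ forall i, moved (nth m hs i) (join m b).
  by move=> /(hsP _ ab) bl; apply: nl; exists b.
exists i => b' bb' kbb'; apply: ni; exists (join (nth m hs i) b').
by split=> //; exact: same_type_refl.
Qed.

Section InvariantType.
Variables (a : I -> C) (Q J : Type) (n : Q -> C) (pi : J -> Q -> Q).
Hypotheses (QS : le_card Q S) (ninv : forall j, same_type n (n \o pi j)).
Hypothesis near_over : forall b b' : I -> C,
  same_type (join n b) (join n b') -> near m b b'.
Hypothesis moves_bounded : forall j, exists k, forall b b' : I -> C,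
  same_type (join n b') (join (n \o pi j) b) -> chain m k b b'.
Hypothesis moves_far : forall k b, same_type a b -> exists j, forall b' : I -> C,
  same_type (join n b') (join (n \o pi j) b) -> ~ chain m k b b'.

(** The action on formulas over [n] of the map from [n \o pi j] to [n]: a set of formulas closed
    under [act] has its realizations moved to realizations. *)
Definition act j (D : (Q + I -> C) -> Prop) (u : Q + I -> C) :=
  D (join (u \o inl \o pi j) (u \o inr)).

Lemma definable_reindex (f : Q -> Q) (D : (Q + I -> C) -> Prop) :
  definable D -> definable (fun u => D (join (u \o inl \o f) (u \o inr))).
Proof.
pose g (u : Q + I) : Q + I := match u with inl q => inl (f q) | inr x => inr x end.
move=> dD; apply: definable_iff (definable_comp g dD) _ => u.
by suff -> : u \o g = join (u \o inl \o f) (u \o inr) by []; apply/funext => -[].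
Qed.

Definition word (w : seq J) : Q -> Q := foldr (fun j f => pi j \o f) id w.

Lemma word_same_type w : same_type n (n \o word w).
Proof.
elim: w => [|j w IH] /=; first exact: same_type_refl.
exact: same_type_trans IH (same_type_comp (word w) (ninv j)).
Qed.

(** The bounds of the letters add up. The empty word still costs one step, because [b'] is given
    only up to its type over [n]. *)
Lemma word_bounded w : exists k, forall b b' : I -> C,
  same_type (join n b') (join (n \o word w) b) -> chain m k b b'.
Proof.
elim: w => [|j w [k kP]].
  exists 1 => b b' bb'; apply/chain1/near_sym/near_over; exact: bb'.
have [k' k'P] := moves_bounded j; exists (k' + k) => b b' bb'.
have [b1 bb1] := extend_type C0 satC SK mulS b QS IS (same_type_sym (ninv j)).
apply: (chain_cat (b := b1)); first exact/k'P/same_type_sym.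
apply: kP; apply: same_type_trans bb' _.
by subtype bb1 (fun u : Q + I => match u with inl q => inl (word w q) | inr x => inr x end : Q + I).
Qed.

(* [Sigma] is a maximal consistent invariant set of formulas, that is, a minimal
   closed invariant set of types: every formula that holds at one of its
   points recurs along the orbit of every other point. *)
Lemma recurrent_set : exists Sigma : ((Q + I -> C) -> Prop) -> Prop,
  (exists c, same_type a c /\ forall D, Sigma D -> D (join n c)) /\
  (forall D, Sigma D -> definable D) /\
  forall b, same_type a b -> (forall D, Sigma D -> D (join n b)) ->
    forall D, definable D -> D (join n b) -> forall k, exists b',
      [/\ forall E, Sigma E -> E (join n b'), D (join n b'),
          exists l, chain m l b b' & ~ chain m k b b'].
Proof.
pose good (X : set ((Q + I -> C) -> Prop)) :=
  [/\ forall D, X D -> definable D, forall D j, X D -> X (act j D) &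
      forall l, allP X l -> exists x, same_type a x /\ allP (fun D => D (join n x)) l].
have [F FP tot|X [[Xdef Xact Xfin] Xmax]] := @Zorn_bigcup _ good.
  split=> [D [A FA AD]|D j [A FA AD]|l].
  - by have [Adef _ _] := FP _ FA; exact: Adef.
  - by exists A => //; have [_ Aact _] := FP _ FA; exact: Aact.
  have [[A0 FA0] lF|F0] := EM (exists A, F A); last first.
    case: l => [_|D l [[A FA]]]; last by case: F0; exists A.
    by exists a; split=> //; exact: same_type_refl.
  suff [A FA /= lA] : exists2 A, F A & allP A l by have [_ _] := FP _ FA; exact.
  elim: l lF => [_|D l IH [[B FB BD] /IH[A FA lA]]]; first by exists A0.
  case: (tot _ _ FA FB) => AB; [exists B|exists A] => //; split=> //; last exact: AB.
  exact: allP_imp lA.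
exists X; split; last split=> // [b ab bX D dD Db k].
  pose p D := X D \/ definable D /\ forall x, same_type a x -> D (join n x).
  have [||c cP] := realize C0 satC SK mulS (g := n) (p := p) QS IS.
  - by move=> D [/Xdef|[]].
  - move=> l pl; suff [l' Xl' l'P] : exists2 l', allP X l' &
        forall x, same_type a x -> allP (fun D => D (join n x)) l' ->
          allP (fun D => D (join n x)) l.
      by have [x [ax xl']] := Xfin _ Xl'; exists x; exact: l'P.
    elim: l pl => [_|D l IH [[XD|[_ aD]] /IH[l' Xl' l'P]]]; first by exists [::].
      by exists (D :: l') => // x ax [Dx /(l'P _ ax)].
    by exists l' => // x ax xl'; split; [exact: aD|exact: l'P].
  exists c; split=> [|D XD]; last by apply: cP; left.
  apply: closed_type => D dD aD; apply: (cP (fun u => D (u \o inr))).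
  by right; split; [exact: definable_comp|move=> x /aD].
(* If no finite list of words worked, the conditions [avoid w] would be consistent with [X]. They
   form an invariant family, so maximality would put [avoid [::]], the negation of [D], into [X],
   against [D] at [b]. *)
have [ws wsP] : exists ws : seq (seq J), forall x, same_type a x ->
    (forall E, X E -> E (join n x)) -> ~ allP (fun w => ~ D (join (n \o word w) x)) ws.
  apply: contrapT => /forallNP nws.
  pose avoid w (u : Q + I -> C) := ~ D (join (u \o inl \o word w) (u \o inr)).
  have XB : X (avoid [::]).
    apply: contrapT => nX; apply: (Xmax (fun E => X E \/ exists w, E = avoid w)).
      split; first by move=> E XE; left.
      by move/(_ (avoid [::])) => h; apply: nX; apply: h; right; exists [::].
    split=> [E [/Xdef//|[w ->]]|E j [XE|[w ->]]|l lB].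
    - exact: definable_not (definable_reindex (word w) dD).
    - by left; exact: Xact.
    - by right; exists (j :: w).
    have [ws wsP] : exists ws, forall x, (forall E, X E -> E (join n x)) ->
        allP (fun w => ~ D (join (n \o word w) x)) ws -> allP (fun E => E (join n x)) l.
      elim: l lB => [_|E l IH [[XE|[w ->]] /IH[ws wsP]]]; first by exists [::].
        by exists ws => x xX xws; split; [exact: xX|exact: wsP].
      by exists (w :: ws) => x xX [xw xws]; split; [exact: xw|exact: wsP].
    have /existsNP[x /not_implyP[ax /not_implyP[xX /contrapT xws]]] := nws ws.
    by exists x; split=> //; exact: wsP.
  exact: (bX _ XB).
have [k0 k0P] : exists k0, allP (fun w => forall b b' : I -> C,
    same_type (join n b') (join (n \o word w) b) -> chain m k0 b b') ws.
  elim: {wsP}ws => [|w ws [k1 k1P]]; first by exists 0.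
  have [k2 k2P] := word_bounded w; exists (k2 + k1); split.
    by move=> c c' /k2P; apply: chain_le; exact: leq_addr.
  apply: allP_imp k1P => w' k1P c c' /k1P; apply: chain_le; exact: leq_addl.
(* [k0] bounds all words of [ws], so [j] can be chosen after it: it moves [b] to a [b1] farther than
   k0 + k, and some word then brings [b1] back into [D] at cost [k0]. *)
have [j jfar] := moves_far (k0 + k) ab.
have [b1 bb1] := extend_type C0 satC SK mulS b QS IS (same_type_sym (ninv j)).
have b1X E : X E -> E (join n b1).
  move=> XE; apply: same_type_definable (Xdef _ XE) bb1 _; exact: (bX _ (Xact _ j XE)).
have ab1 : same_type a b1 by apply: same_type_trans ab _; subtype bb1 (@inr Q I).
have [w wk0 Dw] : exists2 w, forall b b' : I -> C,
    same_type (join n b') (join (n \o word w) b) -> chain m k0 b b' &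
    D (join (n \o word w) b1).
  have := wsP _ ab1 b1X; elim: {wsP}ws k0P => [_ []//|w ws IH [wk0 /IH{}IH]] nws.
  have [Dw|nDw] := EM (D (join (n \o word w) b1)); first by exists w.
  by apply: IH => ws'; apply: nws.
(* The word acts on [b] and [b1] together, so [c] and [b2] are as far apart as [b] and [b1]. As [c]
   is within [k0] of [b], the point [b2] is farther than [k] from [b]. *)
have [cc ccP] := extend_type C0 satC SK mulS (join b b1) QS (small_sum mulS IS IS)
  (same_type_sym (word_same_type w)).
pose c := cc \o inl; pose b2 := cc \o inr.
have bc : same_type (join (n \o word w) b) (join n c).
  by subtype ccP (fun u : Q + I => match u with inl q => inl q | inr x => inr (inl x) end
    : Q + (I + I)).
have b1b2 : same_type (join (n \o word w) b1) (join n b2).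
  by subtype ccP (fun u : Q + I => match u with inl q => inl q | inr x => inr (inr x) end
    : Q + (I + I)).
have kb1b2 := wk0 _ _ (same_type_sym b1b2).
have kbc := wk0 _ _ (same_type_sym bc).
exists b2; split.
- move=> E XE; apply: same_type_definable (Xdef _ XE) b1b2 _.
  suff : X (fun u => E (join (u \o inl \o word w) (u \o inr))) by move/b1X.
  elim: {kb1b2 kbc bc Dw wk0 ccP}w => [|j' w /(Xact _ j')//] /=.
  suff <- : E = fun u => E (join (u \o inl \o id) (u \o inr)) by [].
  by apply/funext => u; congr (E _); apply/funext => -[].
- exact: same_type_definable dD b1b2 Dw.
- have [k1 k1P] := moves_bounded j; exists (k1 + k0).
  by apply: chain_cat kb1b2; exact/k1P/same_type_sym.
- move=> kbb2; apply: (jfar b1 (same_type_sym bb1)).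
  have kcb2 := chain_cat (chain_sym kbc) kbb2.
  apply: (chain_inv C0 satC SK mulS PS IS) kcb2.
  by apply: same_type_sym; subtype ccP (@inr Q (I + I)).
Qed.
End InvariantType.
End Recurrence.

Section RecurrentModel.
Variables (L : language) (C : structure L).
Variables (K S : Type).
Hypotheses (C0 : inhabited C) (satC : saturated C K) (SK : lt_card S K).
Hypothesis (mulS : le_card (S * nat) S).
Variables (P I : Type) (p0 p1 : P).
Hypotheses (p01 : p0 <> p1) (formP : le_card (definable_set C) P).
Hypotheses (powP : le_card (nat -> P) P) (PS : le_card P S) (IS : le_card I S).
Variable (m : P -> C).

Lemma recurrent_model (a : I -> C) : unbounded_chain m a ->
  exists (n : nat * P -> C) (Sigma : ((nat * P + I -> C) -> Prop) -> Prop),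
  [/\ model_enum n,
      forall b b' : I -> C, same_type (join n b) (join n b') -> near m b b',
      forall D, Sigma D -> D (join n a) &
      forall b, same_type a b -> (forall D, Sigma D -> D (join n b)) ->
        forall D, definable D -> D (join n b) -> forall k, exists b',
          [/\ forall E, Sigma E -> E (join n b'), D (join n b'),
              exists l, chain m l b b' & ~ chain m k b b']].
Proof.
move=> ua; pose Q := (nat * P)%type.
have QS : le_card Q S by exact: small_mul (le_card_refl nat) PS.
have /choice[hs hsP] k := separating_maps C0 satC SK mulS PS IS k ua.
pose h (j : nat * nat) := nth m (hs j.1) j.2.
have hm j : exists l, chain m l m (h j).
  have [hsm _] := hsP j.1; rewrite /h; elim: (hs j.1) j.2 hsm => [|x l IH] [|i] /=.
  - by exists 0.
  - by exists 0.
  - by case.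
  - by move=> [_ /IH].
have mh j : same_type m (h j) by have [l] := hm j; exact: chain_same_type.
have [n [pi [iota [nM npi niota npiota]]]] := invariant_model C0 satC SK mulS p01 formP powP PS
  (le_card_pickle (nat * nat)%type) mh.
have niE p : m p = n (iota p) by rewrite -niota.
have hE j p : h j p = n (pi j (iota p)) by rewrite -npiota.
pose r (u : I + P) : Q + I := match u with inl x => inr x | inr p => inl (iota p) end.
have near_n (b b' : I -> C) : same_type (join n b) (join n b') -> near m b b'.
  by move=> bb'; exists m; split; [exact: same_type_refl|subtype bb' r; exact: niE].
have moves j (b b' : I -> C) : same_type (join n b') (join (n \o pi j) b) ->
    same_type (join b' m) (join b (h j)).
  by move=> bb'; subtype bb' r; [exact: niE|exact: hE].
have bounded j : exists k, forall b b' : I -> C,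
    same_type (join n b') (join (n \o pi j) b) -> chain m k b b'.
  (* Carrying [b] along from [h j] to [m] costs [l]; one more step is due because [b'] is known only
     up to its type over [m]. *)
  have [l ml] := hm j; exists (l + 1) => b b' /moves bb'.
  have [c hbc bc] := extend_chain C0 satC SK mulS PS b PS IS (chain_sym ml).
  apply: chain_cat bc _; apply/chain1; exists m; split; first exact: same_type_refl.
  by apply: same_type_sym; apply: same_type_trans bb' _; exact: same_type_swap.
have far k b : same_type a b -> exists j, forall b' : I -> C,
    same_type (join n b') (join (n \o pi j) b) -> ~ chain m k b b'.
  move=> ab; have [_ /(_ b ab)[i iP]] := hsP k.
  by exists (k, i) => b' /moves; exact: iP.
have [Sigma [[c [ac cS]] [Sdef Srec]]] :=
  recurrent_set C0 satC SK mulS PS IS QS npi near_n bounded far.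
(* An elementary map taking [c] to [a] takes [n] to [n']. The properties of [n] pass to [n'] because
   chains depend only on the type of the pair of their ends. *)
have [n' cna] := extend_type C0 satC SK mulS n IS QS (same_type_sym ac).
have nn' : same_type n n' by subtype cna (@inr I Q).
have inv := chain_inv C0 satC SK mulS PS IS.
exists n', Sigma; split.
- exact: model_enum_same_type nn' nM.
- move=> b b' bb'.
  have [d dP] := extend_type C0 satC SK mulS (join b b') QS (small_sum mulS IS IS)
    (same_type_sym nn').
  have E1 : same_type (join n' b) (join n (d \o inl)).
    by subtype dP (fun u : Q + I => match u with inl q => inl q | inr x => inr (inl x) end
      : Q + (I + I)).
  have E2 : same_type (join n' b') (join n (d \o inr)).
    by subtype dP (fun u : Q + I => match u with inl q => inl q | inr x => inr (inr x) end
      : Q + (I + I)).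
  have /near_n/chain1 dd := same_type_trans (same_type_sym E1) (same_type_trans bb' E2).
  have [e [be eb']] : chain m 1 b b'.
    by apply: inv dd; apply: same_type_sym; subtype dP (@inr Q (I + I)).
  by rewrite -eb'.
- move=> D SD.
  by apply: same_type_definable (Sdef _ SD) (same_type_swap cna) _; exact: cS.
- move=> b ab bS D dD Db k.
  have [b0 bb0] := extend_type C0 satC SK mulS b QS IS (same_type_sym nn').
  have ab0 : same_type a b0 by apply: same_type_trans ab _; subtype bb0 (@inr Q I).
  have b0S E : Sigma E -> E (join n b0).
    by move=> SE; apply: same_type_definable (Sdef _ SE) bb0 _; exact: bS.
  have [b1 [b1S Db1 [l lb] kb]] :=
    Srec _ ab0 b0S _ dD (same_type_definable dD bb0 Db) k.
  have [b' b'P] := extend_type C0 satC SK mulS b1 (small_sum mulS QS IS) IS (same_type_sym bb0).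
  have E1 : same_type (join n b1) (join n' b').
    by subtype b'P (fun u : Q + I => match u with inl q => inl (inl q) | inr x => inr x end
      : (Q + I) + I).
  have E2 : same_type (join b0 b1) (join b b').
    by subtype b'P (fun u : I + I => match u with inl q => inl (inr q) | inr x => inr x end
      : (Q + I) + I).
  exists b'; split.
  + by move=> E SE; apply: same_type_definable (Sdef _ SE) E1 _; exact: b1S.
  + exact: same_type_definable dD E1 Db1.
  + by exists l; exact: inv E2 lb.
  + by move=> kbb'; apply: kb; apply: inv kbb'; exact: same_type_sym.
Qed.

Section Separation.
Variables (Q : Type) (n : Q -> C).
Hypothesis QS : le_card Q S.
Hypothesis near_n : forall b b' : I -> C, same_type (join n b) (join n b') -> near m b b'.

(** Without separating formulas, saturation gives [x] and [y] at distance at most [k] with the types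
    of [b] and [b'] over [n]. They are near [b] and [b'], which accounts for the two extra steps. *)
Lemma separate_types k (b b' : I -> C) : ~ chain m k.+2 b b' ->
  exists D D' : (Q + I -> C) -> Prop,
  [/\ definable D /\ definable D', D (join n b), D' (join n b') &
      forall x y, D (join n x) -> D' (join n y) -> ~ chain m k x y].
Proof.
move=> nbb'; apply: contrapT => nsep.
pose f1 (u : Q + I) : Q + (I + I) := match u with inl q => inl q | inr x => inr (inl x) end.
pose f2 (u : Q + I) : Q + (I + I) := match u with inl q => inl q | inr x => inr (inr x) end.
have E1 g (w : I + I -> C) : join g w \o f1 = join g (w \o inl) by apply/funext => -[].
have E2 g (w : I + I -> C) : join g w \o f2 = join g (w \o inr) by apply/funext => -[].
pose p (E : (Q + (I + I) -> C) -> Prop) := definable E /\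
  [\/ exists D, [/\ definable D, D (join n b) & E = fun u => D (u \o f1)],
      exists D, [/\ definable D, D (join n b') & E = fun u => D (u \o f2)] |
      forall w : I + I -> C, chain m k (w \o inl) (w \o inr) -> E (join n w)].
have [|w wP] := realize C0 satC SK mulS (g := n) QS (small_sum mulS IS IS)
  (fun E (pE : p E) => pE.1).
  move=> l pl; have [D [D' [[dD dD'] Db Db' DD']]] : exists D D' : (Q + I -> C) -> Prop,
      [/\ definable D /\ definable D', D (join n b), D' (join n b') &
          forall w, D (join n (w \o inl)) -> D' (join n (w \o inr)) ->
            chain m k (w \o inl) (w \o inr) -> allP (fun E => E (join n w)) l].
    elim: l pl => [_|E l IH [[dE pE] /IH[D [D' [[dD dD'] Db Db' DD']]]]].
      exists (fun _ => True), (fun _ => True); split=> //.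
      by split; exact: definable_true.
    case: pE => [[D1 [dD1 D1b ->]]|[D1 [dD1 D1b ->]]|kE].
    - exists (fun u => D1 u /\ D u), D'; split=> //; first by split=> //; exact: definable_and.
      by move=> w [D1w Dw] D'w kw; split; [rewrite E1|exact: DD'].
    - exists D, (fun u => D1 u /\ D' u); split=> //; first by split=> //; exact: definable_and.
      by move=> w Dw [D1w D'w] kw; split; [rewrite E2|exact: DD'].
    - by exists D, D'; split=> // w Dw D'w kw; split; [exact: kE|exact: DD'].
  apply: contrapT => nl; apply: nsep; exists D, D'; split=> // x y Dx D'y kxy.
  by apply: nl; exists (join x y); exact: DD'.
pose x := w \o inl; pose y := w \o inr.
have bx : near m b x.
  apply: near_n => phi; suff H psi : sat psi (join n b) -> sat psi (join n x).
    by split; [exact: H|apply: contraPP; exact: (H (fneg phi))].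
  move=> bpsi; rewrite /x -E1; apply: (wP (fun u => sat psi (u \o f1))); split.
    by apply: definable_comp; exact: definable_sat.
  by apply: Or31; exists (sat psi); split=> //; exact: definable_sat.
have b'y : near m b' y.
  apply: near_n => phi; suff H psi : sat psi (join n b') -> sat psi (join n y).
    by split; [exact: H|apply: contraPP; exact: (H (fneg phi))].
  move=> bpsi; rewrite /y -E2; apply: (wP (fun u => sat psi (u \o f2))); split.
    by apply: definable_comp; exact: definable_sat.
  by apply: Or32; exists (sat psi); split=> //; exact: definable_sat.
have kxy : chain m k x y.
  apply: (@closed_chain _ _ _ _ C0 satC SK mulS _ m PS I k IS w) => D dD kD.
  apply: (wP (fun u => D (u \o inr))); split; first exact: definable_comp.
  by apply: Or33 => w' /kD.
apply: nbb'; exists x; split=> //.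
by rewrite -addn1; apply: chain_cat kxy (chain1 (near_sym b'y)).
Qed.
End Separation.
End RecurrentModel.

(** * The Choquet game *)

(* [R k x y] abstracts "x and y are at distance at most k", and [G] a set of points at
   pairwise finite distance, each of whose nonempty open pieces is unbounded. *)
Section ChoquetTree.
Variables (X F : Type) (tpf : X -> F -> Prop) (Y G : X -> Prop) (R : nat -> X -> X -> Prop).
Hypothesis GY : forall b, G b -> Y b.
Hypothesis formula_true : exists chi, forall b, tpf b chi.
Hypothesis formula_and : forall phi psi, exists chi, forall b,
  tpf b chi <-> tpf b phi /\ tpf b psi.
Hypothesis R_le : forall k l b b', k <= l -> R k b b' -> R l b b'.
Hypothesis R_sym : forall k b b', R k b b' -> R k b' b.
Hypothesis far : forall b phi k zs, G b -> allP G zs -> tpf b phi ->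
  exists b', [/\ G b', tpf b' phi & allP (fun z => ~ R k z b') zs].
Hypothesis separate : forall k b b', ~ R k.+2 b b' -> exists phi phi',
  [/\ tpf b phi, tpf b' phi' & forall x y, tpf x phi -> tpf y phi' -> ~ R k x y].

Definition types_of (p : F -> Prop) := exists a, Y a /\ p = tpf a.
Notation open_types := (type_open types_of).

Lemma formula_conj (X' : Type) (phi : X' -> F) l : exists chi, forall b,
  tpf b chi <-> allP (fun i => tpf b (phi i)) l.
Proof.
elim: l => [|i l [chi chiP]] /=; first by have [chi ?] := formula_true; exists chi.
by have [chi' chi'P] := formula_and (phi i) chi; exists chi' => b; rewrite chi'P chiP.
Qed.

Lemma open_types_and (V : (F -> Prop) -> Prop) phi :
  open_types V -> open_types (fun p => V p /\ p phi).
Proof.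
move=> [VX Vo]; split=> [p [/VX]//|p [Vp pphi]].
have [psi [ppsi psiV]] := Vo _ Vp; have [chi chiP] := formula_and phi psi.
have [b [_ pb]] := VX _ Vp; rewrite pb in pphi ppsi *.
exists chi; split; first exact/chiP.
by move=> q [c [Yc ->]] /chiP[cphi cpsi]; split=> //; apply: psiV => //; exists c.
Qed.

(** Points are first chosen one at a time, each far from all earlier ones; the open sets are then
    shrunk by finitely many separating formulas. Distance beyond k + 2 between points leaves
    distance beyond [k] between open sets. *)
Lemma spread_level (T : finType) (V : T -> (F -> Prop) -> Prop) (b : T -> X) k :
  (forall t, [/\ open_types (V t), V t (tpf (b t)) & G (b t)]) ->
  exists (b' : T -> X) (U : T -> (F -> Prop) -> Prop),
    (forall t, [/\ open_types (U t), U t (tpf (b' t)), G (b' t) &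
       forall p, U t p -> V t p]) /\
    forall t t', t <> t' -> forall x y, U t (tpf x) -> U t' (tpf y) -> ~ R k x y.
Proof.
move=> Vb.
have [b' b'P] : exists b' : T -> X,
    (forall t, t \in enum T -> V t (tpf (b' t)) /\ G (b' t)) /\
    forall t t', t \in enum T -> t' \in enum T -> t <> t' -> ~ R k.+2 (b' t) (b' t').
  elim: (enum T) (enum_uniq T) => [_|t0 l IH /= /andP[t0l /IH[b' [b'V b'R]]]]; first by exists b.
  have [[_ Vo] Vt0 Gt0] := Vb t0; have [phi [bphi phiV]] := Vo _ Vt0.
  have Gl : allP G (map b' l) by rewrite allP_map allP_mem => t /b'V[].
  have [c [Gc cphi]] := far k.+2 Gt0 Gl bphi.
  rewrite allP_map allP_mem => cl.
  have Vc : V t0 (tpf c) by apply: phiV => //; exists c; split=> //; exact: GY.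
  pose b'' t := if t == t0 then c else b' t.
  exists b''; split=> [t|t t']; rewrite !inE /b''.
    by case: eqP => [->|_ /=]; [|exact: b'V].
  case: (t =P t0) => [->|tt0] /=; case: (t' =P t0) => [->|t't0] //=.
  - by move=> _ t'l _ /R_sym; exact: cl.
  - by move=> tl _ _; exact: cl.
  - exact: b'R.
have {b'P} [b'V b'R] : (forall t, V t (tpf (b' t)) /\ G (b' t)) /\
    forall t t', t <> t' -> ~ R k.+2 (b' t) (b' t').
  by case: b'P => b'V b'R; split=> [t|t t']; [apply: b'V|apply: b'R]; rewrite mem_enum.
have [top topP] := formula_true.
have /choice[phi phiP] (u : T * T) : exists phi : F * F,
    [/\ tpf (b' u.1) phi.1, tpf (b' u.2) phi.2 &
        u.1 <> u.2 -> forall x y, tpf x phi.1 -> tpf y phi.2 -> ~ R k x y].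
  have [uu|uu] := EM (u.1 = u.2); first by exists (top, top).
  have [phi [phi' [bphi bphi' phiR]]] := separate (b'R _ _ uu).
  by exists (phi, phi').
have /choice[chi chiP] (t : T) : exists chi, forall c, tpf c chi <->
    allP (fun t' => tpf c (phi (t, t')).1) (enum T) /\
    allP (fun t' => tpf c (phi (t', t)).2) (enum T).
  have [c1 c1P] := formula_conj (fun t' => (phi (t, t')).1) (enum T).
  have [c2 c2P] := formula_conj (fun t' => (phi (t', t)).2) (enum T).
  by have [c cP] := formula_and c1 c2; exists c => d; rewrite cP c1P c2P.
exists b', (fun t p => V t p /\ p (chi t)); split=> [t|t t' tt' x y [_ /chiP[xt _]] [_ /chiP[_ yt']]].
  have [Vo _ _] := Vb t; have [Vt Gt] := b'V t; split=> //; first exact: open_types_and.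
    split=> //; apply/chiP; split; apply: allP_all => t'.
      by have [] := phiP (t, t').
    by have [] := phiP (t', t).
  by move=> p [].
have [_ _] := phiP (t, t'); apply=> //.
  by move/allP_mem: xt; apply; rewrite mem_enum.
by move/allP_mem: yt'; apply; rewrite mem_enum.
Qed.

Lemma A_legal_ext (sigma : strategy (F -> Prop)) u u' n :
  (forall i, i <= n -> u i = u' i) ->
  A_legal types_of open_types sigma u n -> A_legal types_of open_types sigma u' n.
Proof.
move=> uu' uA k kn; rewrite -uu' //.
suff -> : match k with 0 => types_of | k'.+1 => sigma (mkseq u' k) end =
          match k with 0 => types_of | k'.+1 => sigma (mkseq u k) end by exact: uA.
case: k kn => // k kn; congr sigma; apply/eq_in_map => i; rewrite mem_iota => /= ik.
by rewrite uu' // (leq_trans _ kn) // ltnW.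
Qed.

Lemma choquet_tree : strong_choquet types_of open_types -> (exists a, G a) ->
  exists f : (nat -> bool) -> X,
    (forall s, Y (f s)) /\ (forall s t, (exists k, R k (f s) (f t)) -> s = t).
Proof.
move=> [sigma [sigma1 sigma2]] [a Ga].
(* The default of [nth] is also player A's opening move, common to all branches. *)
pose dft : move (F -> Prop) := (types_of, tpf a).
pose legal l := A_legal types_of open_types sigma (nth dft l) (size l).-1.
have mkseq_nth' l : mkseq (nth dft l) (size l) = l by exact: mkseq_nth.
have openX : open_types types_of.
  split=> // p [b [Yb ->]]; have [top topP] := formula_true.
  by exists top; split.
have reply l : 0 < size l -> legal l -> [/\ open_types (sigma l),
    sigma l (last dft l).2 & forall p, sigma l p -> (last dft l).1 p].
  move=> l0 lA; have := sigma1 _ _ lA.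
  by rewrite prednK // mkseq_nth' nth_last.
have legal_rcons l U p : 0 < size l -> legal l -> open_types U -> U p ->
    (forall q, U q -> sigma l q) -> legal (rcons l (U, p)).
  move=> l0 lA Uo Up Ul k; rewrite /legal size_rcons /=.
  rewrite leq_eqVlt => /predU1P[->|kl].
    rewrite nth_rcons ltnn eqxx; split=> //.
    suff E : mkseq (nth dft (rcons l (U, p))) (size l) = l by case: (l) l0 E Ul => // ? ? _ ->.
    rewrite -[RHS]mkseq_nth'; apply/eq_in_map => i; rewrite mem_iota => /= il.
    by rewrite nth_rcons il.
  apply: (A_legal_ext (u := nth dft l) (n := (size l).-1)) => [i|//|]; last by rewrite -ltnS prednK.
  by rewrite -ltnS prednK // nth_rcons => ->.
(* A state assigns to a node of the binary tree the moves of player A on the way to it and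
   the point last played there. *)
pose state := ((seq bool -> seq (move (F -> Prop))) * (seq bool -> X))%type.
pose inv k (st : state) := forall s, size s = k ->
  [/\ size (st.1 s) = k.+1, legal (st.1 s), G (st.2 s) & (last dft (st.1 s)).2 = tpf (st.2 s)].
pose step k (st st' : state) := exists U : seq bool -> (F -> Prop) -> Prop,
  (forall s, size s = k.+1 -> st'.1 s = rcons (st.1 (take k s)) (U s, tpf (st'.2 s))) /\
  forall s s', size s = k.+1 -> size s' = k.+1 -> s <> s' ->
    forall x y, U s (tpf x) -> U s' (tpf y) -> ~ R k x y.
have /choice[next nextP] (u : nat * state) : exists st', inv u.1 u.2 ->
    inv u.1.+1 st' /\ step u.1 u.2 st'.
  case: u => k [h b] /=; have [kinv|] := EM (inv k (h, b)); last by exists (h, b).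
  have take_size (t : k.+1.-tuple bool) : size (take k t) = k.
    by rewrite size_take size_tuple ltnSn.
  have [|b' [U [b'U UR]]] := @spread_level (k.+1.-tuple bool)
      (fun t => sigma (h (take k t))) (fun t => b (take k t)) k.
    move=> t; have [/= hs hl Gb hb] := kinv _ (take_size t).
    have [|ho hv _] := reply _ _ hl; first by rewrite hs.
    by rewrite -hb.
  (* [spread_level] needs a finite index type, so nodes of length k + 1 are read as tuples. *)
  pose node s : k.+1.-tuple bool := insubd [tuple of nseq k.+1 true] s.
  have nodeE s : size s = k.+1 -> tval (node s) = s.
    by move=> sk; rewrite /node val_insubd sk eqxx.
  exists (fun s => rcons (h (take k s)) (U (node s), tpf (b' (node s))), b' \o node) => _.
  split=> [s sk|].
    have [Uo Ub Gb UV] := b'U (node s); rewrite nodeE // in UV.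
    have ks : size (take k s) = k by rewrite size_take sk ltnSn.
    have [/= hs hl _ _] := kinv _ ks.
    split=> //=; [by rewrite size_rcons hs| |by rewrite last_rcons].
    by apply: legal_rcons => //; rewrite hs.
  exists (U \o node); split=> // s s' sk s'k ss'; apply: UR => nn.
  by apply: ss'; rewrite -(nodeE s) // nn nodeE.
pose st0 : state := (fun=> [:: dft], fun=> a).
pose st k := iteri k (fun i s => next (i, s)) st0.
have st_inv k : inv k (st k).
  elim: k => [|k IH]; last by have [] := nextP (k, st k) IH.
  move=> s _; split=> //= -[|//] _ /=; split=> //; first by exists a; split=> //; exact: GY.
have st_step k : step k (st k) (st k.+1) by have [] := nextP (k, st k) (st_inv k).
pose hist eta k := (st k).1 (mkseq eta k).
have hist_size eta k : size (hist eta k) = k.+1.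
  by have [] := st_inv k (mkseq eta k) (size_mkseq _ _).
have take_mkseq eta k : take k (mkseq eta k.+1) = mkseq eta k :> seq bool.
  have tk : size (take k (mkseq eta k.+1)) = k by rewrite size_take size_mkseq ltnSn.
  apply: (@eq_from_nth _ true) => [|i]; rewrite tk ?size_mkseq // => ik.
  by rewrite nth_take // !nth_mkseq // ltnW.
have hist_rcons eta k : hist eta k.+1 = rcons (hist eta k) (last dft (hist eta k.+1)).
  have [U [hU _]] := st_step k.
  by rewrite /hist hU ?size_mkseq // take_mkseq last_rcons.
pose u eta k := last dft (hist eta k).
have hist_mkseq eta k : mkseq (u eta) k.+1 = hist eta k.
  elim: k => [|k IH]; first by [].
  by rewrite [RHS]hist_rcons -IH /mkseq -[in LHS](addn1 k.+1) iotaD map_cat cats1.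
have u_legal eta k : A_legal types_of open_types sigma (u eta) k.
  have [_ hl _ _] := st_inv k (mkseq eta k) (size_mkseq _ _).
  have := hl; rewrite /legal -/(hist eta k) hist_size; apply: A_legal_ext => i ik.
  by rewrite -hist_mkseq nth_mkseq.
have /choice[f fP] eta : exists y, Y y /\ forall k, (u eta k).1 (tpf y).
  have [p pP] := sigma2 _ (u_legal eta).
  have up k : (u eta k).1 p by have [_ _] := sigma1 _ _ (u_legal eta k); apply.
  by have [y [Yy py]] := up 0; exists y; split=> // k; rewrite -py.
exists f; split=> [s|s t [k kst]]; first by have [] := fP s.
apply: contrapT => st'; have [i sti] : exists i, s i <> t i.
  by apply: contrapT => /forallNP nst; apply: st'; apply/funext => i; apply: contrapT; exact: nst.
(* The nodes of length l + 1 already differ at [i], and their open sets are more than [l], hence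
   more than [k], apart. *)
pose l := maxn i k; have [U [hU UR]] := st_step l.
have uU eta : (u eta l.+1).1 = U (mkseq eta l.+1).
  by rewrite /u /hist hU ?size_mkseq // last_rcons.
apply: (UR (mkseq s l.+1) (mkseq t l.+1)) (R_le (leq_maxr i k) kst); rewrite ?size_mkseq //.
- move=> /(f_equal (fun l => nth true l i)); rewrite !nth_mkseq ?ltnS ?leq_maxl //.
- by rewrite -uU; have [_] := fP s.
- by rewrite -uU; have [_] := fP t.
Qed.
End ChoquetTree.

(** * Conclusion *)

Section DefinableSetSize.
Variables (L : language) (C : structure L).

Lemma le_card_definable_set : le_card (definable_set C) (formula L nat).
Proof.
have /choice[phi phiP] (D : definable_set C) : exists phi : formula L nat,
    forall g, sat phi g <-> sval D g by exact: (svalP D).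
exists phi => D D' e; apply: sval_inj; apply/funext => g; apply/propext.
by rewrite -!phiP e.
Qed.

Lemma le_card_nat_definable_set (c d : C) : c <> d -> le_card nat (definable_set C).
Proof.
move=> cd; exists (fun k => exist _ _ (definable_eq C 0 k.+1)) => k l.
move/(f_equal (fun D => sval D (fun i => if (i == 0) || (i == k.+1) then c else d))) => /=.
rewrite eqxx eqSS; case: (l =P k) => [->//|_] e.
by case: cd; rewrite -e.
Qed.
End DefinableSetSize.

Section UnboundedClass.
Variables (L : language) (C : structure L).
Variables (K S : Type).
Hypotheses (C0 : inhabited C) (satC : saturated C K) (SK : lt_card S K).
Hypothesis (mulS : le_card (S * nat) S).
Variables (P I : Type) (p0 p1 : P).
Hypotheses (p01 : p0 <> p1) (formP : le_card (definable_set C) P).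
Hypotheses (powP : le_card (nat -> P) P) (PS : le_card P S) (IS : le_card I S).

Lemma dist_le_chain (m : P -> C) k (a b : I -> C) : dist_le k a b -> chain m k a b.
Proof.
elim: k a => //= k IH a [c [ac /IH cb]]; exists c; split=> //.
by case: ac => [->|/(adj_near C0 satC SK mulS m PS IS)]; [exact: near_refl|].
Qed.

Lemma chain_dist_le (m : P -> C) k (a b : I -> C) :
  model_enum m -> chain m k a b -> dist_le k.*2 a b.
Proof.
move=> mM; elim: k a => [//|k IH a [c [[z [mz ac]] /IH cb]]].
rewrite doubleS -add2n; apply: dist_le_cat cb.
exact: (same_type_dist C0 satC SK mulS PS IS p0 (model_enum_same_type mz mM) ac).
Qed.

(** If the class of [a] lay within [k] of [a], any two of its points would be joined through [a] by
    a chain of length k + k, hence be at Lascar distance at most twice that. *)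
Lemma unbounded_lascar_chain (m : P -> C) (a : I -> C) :
  model_enum m -> ~ d_bounded (lascar_class a) -> unbounded_chain m a.
Proof.
move=> mM /unbounded_far_pair far k; have [x [y [[l ax] [l' ay] xy]]] := far (k + k).*2.
apply: contrapT => /forallNP nb; apply: xy; apply: chain_dist_le mM _.
have kn b i : dist_le i a b -> chain m k a b.
  move=> ab; apply: contrapT => kab; apply: (nb b); split=> //.
  by exists i; exact: dist_le_chain.
exact: chain_cat (chain_sym (kn _ _ ax)) (kn _ _ ay).
Qed.

Lemma choquet_unbounded (Y : (I -> C) -> Prop) (a : I -> C) :
  lascar_closed Y -> Y a -> ~ d_bounded (lascar_class a) -> pseudo_strong_choquet K Y ->
  exists f : (nat -> bool) -> I -> C,
    (forall s, Y (f s)) /\ (forall s t, lascar_eq (f s) (f t) -> s = t).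
Proof.
move=> Ycl Ya unb Ychoquet.
have [m [mM _]] : exists m : P -> C, model_enum m /\ forall x : P, exists q, m q = m x.
  have [c0] := C0.
  have [m [mM _]] := exists_model C0 p01 formP powP (fun=> c0) p0 (le_card_refl P).
  by exists m; split=> // x; exists x.
have ua := unbounded_lascar_chain mM unb.
have [n [Sigma [nM near_n aS rec]]] :=
  recurrent_model C0 satC SK mulS p01 formP powP PS IS ua.
pose Q := (nat * P)%type.
have QS : le_card Q S by exact: small_mul (le_card_refl nat) PS.
pose M (x : C) := exists q, n q = x.
have smM : small K M by apply: le_lt_card SK; apply: le_card_trans QS; exact: le_card_range.
(* The first condition keeps the points in the Lascar class of [a], hence in [Y]; the second makes
   recurrence applicable. *)
pose G b := (exists l, chain m l a b) /\ forall D, Sigma D -> D (join n b).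
have GY b : G b -> Y b.
  by move=> [[l ab] _]; apply: Ycl Ya _; exists l.*2; exact: chain_dist_le ab.
have of_formula (phi : formula L (I + sig M)) : exists D, definable D /\
    forall b, tp M b phi <-> D (join n b).
  have /choice[g gP] (x : sig M) : exists q, n q = sval x by exact: (svalP x).
  pose r (u : I + sig M) : Q + I := match u with inl i => inr i | inr x => inl (g x) end.
  exists (fun u => sat phi (u \o r)); split.
    by apply: definable_comp; exact: definable_sat.
  move=> b; rewrite /tp; suff -> : join n b \o r =
      fun v => match v with inl i => b i | inr x => sval x end by [].
  by apply/funext => -[//|x] /=; exact: gP.
have to_formula D : definable D -> exists phi : formula L (I + sig M),
    forall b, tp M b phi <-> D (join n b).
  move=> [psi psiD].
  pose r (u : Q + I) : I + sig M := match u with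
    | inl q => inr (exist _ (n q) (ex_intro _ q erefl)) | inr i => inl i end.
  exists (rename psi r) => b; rewrite -psiD /tp sat_rename.
  suff -> : (fun v : I + sig M => match v with inl i => b i | inr x => sval x end) \o r =
      join n b by [].
  by apply/funext => -[].
have [|||||||||f [Yf fP]] := @choquet_tree _ _ (tp M) Y G (fun k => chain m k).
- exact: GY.
- by have [phi phiP] := to_formula _ (@definable_true _ _ C0 (Q + I)%type); exists phi => b; apply/phiP.
- move=> phi psi; exists (fand phi psi) => b; exact: iff_refl.
- by move=> k l b b'; exact: chain_le.
- by move=> k b b'; exact: chain_sym.
- move=> b phi k zs [[l ab] bS] Gzs bphi.
  have [D [dD phiD]] := of_formula phi.
  (* [N] bounds the distances of the earlier points from [b], so a point farther than N + k from [b]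
     is farther than [k] from each of them. *)
  have [N NP] : exists N, allP (fun z => chain m N z b) zs.
    elim: zs Gzs => [|z zs IH] /= => [_|[[[lz az] _] /IH[N NP]]]; first by exists 0.
    exists (lz + l + N); split.
      by apply: chain_le (chain_cat (chain_sym az) ab); exact: leq_addr.
    by apply: allP_imp NP => z'; apply: chain_le; exact: leq_addl.
  have [b' [b'S Db' [l' bb'] kbb']] :=
    rec b (chain_same_type ab) bS D dD (proj1 (phiD b) bphi) (N + k).
  exists b'; split; [split=> //; exists (l + l'); exact: chain_cat bb'|exact/phiD|].
  apply: allP_imp NP => z Nzb kzb'; apply: kbb'; exact: chain_cat (chain_sym Nzb) kzb'.
- move=> k b b' kbb'.
  have [D [D' [[dD dD'] Db Db' DD']]] := separate_types C0 satC SK mulS PS IS QS near_n kbb'.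
  have [[phi phiD] [phi' phiD']] := (to_formula _ dD, to_formula _ dD').
  exists phi, phi'; split; [exact/phiD|exact/phiD'|].
  by move=> x y /phiD Dx /phiD' D'y; exact: DD'.
- exact: Ychoquet smM (model_enum_elementary nM).
- by exists a; split=> //; exists 0.
exists f; split=> // s t [k st]; apply: fP; exists k; exact: dist_le_chain.
Qed.
End UnboundedClass.

Theorem theoremB (L : language) (T : sentence L -> Prop) (C : structure L)
  (K : Type) (I : Type) :
  monster C K T -> lt_card I K ->
  forall Y : (I -> C) -> Prop,
    lascar_closed Y ->
    (exists a, Y a /\ ~ d_bounded (lascar_class a)) ->
    pseudo_strong_choquet K Y ->
    exists f : (nat -> bool) -> I -> C,
      (forall s, Y (f s)) /\ (forall s t, lascar_eq (f s) (f t) -> s = t).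
Proof.
move=> [_ _ C0 FK [satC _]] IK Y Ycl [a [Ya unb]] Ychoquet.
(* The power set [P] of [F] absorbs [nat -> P] once [F] is infinite, and has size at most 2^|T|,
   hence below [K]. Two distinct elements of [C] make [F] infinite. *)
pose F := definable_set C; pose P := F -> bool.
have [c [d cd]] := unbounded_two_points unb.
have natF := le_card_nat_definable_set cd.
have powP : le_card (nat -> P) P by exact/le_card_seq_pow/le_card_mul_nat.
have formP : le_card F P.
  exists (fun D D' => `[< D = D' >]) => D D' e.
  by apply/asboolP; rewrite -(f_equal (fun X => X D') (esym e)); apply/asboolP.
have natP : le_card nat P by exact: le_card_trans natF formP.
have [F0 _] := natF.
have p01 : (xpredT : P) <> xpred0 by move/(f_equal (fun X => X (F0 0))).
have PF : le_card P (formula L nat -> bool).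
  have [r rs] := le_card_surj (F0 0) (le_card_definable_set C).
  exists (fun X phi => X (r phi)) => X Y' e; apply/funext => D; have [phi <-] := rs D.
  exact: (f_equal (fun X => X phi) e).
have PK := le_lt_card PF FK.
(* [S] is the larger of [P] and [I], so that both models and the given tuples fit. *)
have [S [SK PS IS]] : exists S, [/\ lt_card S K, le_card P S & le_card I S].
  by case: (le_card_total P I) => le; [exists I|exists P]; split=> //; exact: le_card_refl.
have mulS := le_card_mul_nat (le_card_trans natP PS).
exact: (choquet_unbounded C0 satC SK mulS p01 formP powP PS IS Ycl Ya unb Ychoquet).
Qed.
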